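(* Let $T$ be a complete first-order theory with monster model $\mathcal M$, and let $\boldsymbol e=a/E$, $\boldsymbol b=b_F$ and $\boldsymbol c=c_L$ be hyperimaginaries with $\boldsymbol c\in\operatorname{acl}(\boldsymbol b\boldsymbol e)$. Put $p=\operatorname{tp}(\boldsymbol b/\boldsymbol e)$ and $\overline p=\operatorname{tp}(\boldsymbol b\boldsymbol c/\boldsymbol e)$, and let $K_1$ be the kernel of the natural projection $\pi_1:\operatorname{Gal}^1_{\operatorname L}(\overline p)\to\operatorname{Gal}^1_{\operatorname L}(p)$. If $T$ is G-compact over $\boldsymbol e$, then $K_1$ is finite.
   Context: Conventions: $\mathcal M$ is a ($\bar\kappa$-saturated) monster model of $T$; small means of cardinality $<\bar\kappa$; real tuples are sequences from $\mathcal M$ of small length. A hyperimaginary $b_F=b/F$ is the class of a real tuple $b$ modulo an $\emptyset$-type-definable equivalence relation $F$; small sequences of hyperimaginaries are treated as single hyperimaginaries. $E$ is an $\emptyset$-type-definable equivalence relation, $a$ a real tuple, $\boldsymbol e=a/E$. $\operatorname{Aut}_{\boldsymbol e}(\mathcal M)=\{f\in\operatorname{Aut}(\mathcal M): f(\boldsymbol e)=\boldsymbol e\}$; $\boldsymbol c\in\operatorname{acl}(\boldsymbol b\boldsymbol e)$ means $\boldsymbol c$ has finitely many images under automorphisms fixing $\boldsymbol b$ and $\boldsymbol e$. $\operatorname{Autf}_{\boldsymbol e}(\mathcal M)$ is the (normal) subgroup of $\operatorname{Aut}_{\boldsymbol e}(\mathcal M)$ generated by all $f\in\operatorname{Aut}_{\boldsymbol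 e}(\mathcal M)$ fixing pointwise some small model $M\prec\mathcal M$ with $\boldsymbol e\in\operatorname{dcl}(M)$ (i.e. $\boldsymbol e$ is fixed by all automorphisms fixing $M$ pointwise). $\boldsymbol u\equiv^{\operatorname L}_{\boldsymbol e}\boldsymbol v$ iff $f(\boldsymbol u)=\boldsymbol v$ for some $f\in\operatorname{Autf}_{\boldsymbol e}(\mathcal M)$. $\operatorname{Gal}_{\operatorname L}(T,\boldsymbol e)=\operatorname{Aut}_{\boldsymbol e}(\mathcal M)/\operatorname{Autf}_{\boldsymbol e}(\mathcal M)$ with projection $\pi$, topologized as follows: for small models $M,N$ with $\boldsymbol e\in\operatorname{dcl}(M)$, $\boldsymbol e\in\operatorname{dcl}(N)$, $S_M(N)=\{\operatorname{tp}(f(M)/N): f\in\operatorname{Aut}_{\boldsymbol e}(\mathcal M)\}$ has the relative Stone topology, and $\operatorname{Gal}_{\operatorname L}(T,\boldsymbol e)$ has the quotient topology under the well-defined map $\operatorname{tp}(f(M)/N)\mapsto\pi(f)$ (independent of $M,N$). $T$ is G-compact over $\boldsymbol e$ if the trivial subgroup is closed in $\operatorname{Gal}_{\operatorname L}(T,\boldsymbol e)$. Relativized Lascar groups: for a hyperimaginary $\boldsymbol d$ and $q=\operatorname{tp}(\boldsymbol d/\boldsymbol e)$, the realizations of $q$ are the images of $\boldsymbol d$ under $\operatorname{Aut}_{\boldsymbol e}(\mathcal M)$ and $q(\mathcal M)$ is the set of realizations. $\operatorname{Aut}(q)=\{f\upharpoonright q(\mathcal M): f\in\operatorname{Aut}_{\boldsymbol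 e}(\mathcal M)\}$; $\operatorname{Autf}^1(q)$ is the (normal) subgroup of those $f\in\operatorname{Aut}(q)$ with $\boldsymbol d'\equiv^{\operatorname L}_{\boldsymbol e}f(\boldsymbol d')$ for every realization $\boldsymbol d'$ of $q$; $\operatorname{Gal}^1_{\operatorname L}(q)=\operatorname{Aut}(q)/\operatorname{Autf}^1(q)$. The natural projection is $\pi_1\bigl((f\upharpoonright\overline p(\mathcal M))\cdot\operatorname{Autf}^1(\overline p)\bigr)=(f\upharpoonright p(\mathcal M))\cdot\operatorname{Autf}^1(p)$ for $f\in\operatorname{Aut}_{\boldsymbol e}(\mathcal M)$, which is well defined. *)

(* Defs.v *)
(* Conventions.
   - A type kappa stands for the cardinal of the monster model: [small kappa A]
     means |A| < |kappa|.
   - Real tuples are functions I -> M on an index type I.  A [td_equiv] is a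
     0-type-definable equivalence relation on I-tuples; a hyperimaginary of
     sort F ([himag F]) is a class of F, and automorphisms act on classes by
     direct image.  The pair bc is again one hyperimaginary, [hpair b c].
   - For e : himag E and d : himag D, with q = tp(d/e):
       autE e        = Aut_e(M)          autf kappa e    = Autf_e(M)
       gal kappa e   = Gal_L(T, e)       realization e d = q(M)
       autq e d      = Aut(q)            autf1 kappa e d = Autf^1(q)
       gal1 kappa e d = Gal^1_L(q)
     and, for p = tp(b/e), pbar = tp(bc/e),
       pi1 : Gal^1_L(pbar) -> Gal^1_L(p), characterized by [pi1E]. *)
From HB Require Import structures.
From mathcomp Require Import all_boot.
From mathcomp Require Import boolp classical_sets functions cardinality.
From mathcomp Require Import topology_structure subspace_topology.

Set Implicit Arguments.
Unset Strict Implicit.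
Unset Printing Implicit Defensive.

Local Open Scope classical_set_scope.
Local Open Scope quotient_scope.
Local Open Scope group_scope.

Record sym (X : Type) := Sym { sym_fun :> X -> X; sym_bij : bijective sym_fun }.

Section SymmetricGroup.
Variable X : Type.

HB.instance Definition _ := gen_eqMixin (sym X).
HB.instance Definition _ := gen_choiceMixin (sym X).

Lemma sym_ext (f g : sym X) : (forall x, f x = g x) -> f = g.
Proof.
case: f g => [f bf] [g bg] /= /funext e.
by subst g; congr Sym; exact: Prop_irrelevance.
Qed.

Lemma sym_inv_ex (f : sym X) : exists g : sym X, cancel f g /\ cancel g f.
Proof. by case: f => f [g fK gK]; exists (Sym (Bijective gK fK)). Qed.

Definition sym_one : sym X := Sym (inv_bij (fun=> erefl : id _ = _)).
Definition sym_mul (f g : sym X) : sym X :=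
  Sym (bij_comp (sym_bij f) (sym_bij g)).
Definition sym_inv (f : sym X) : sym X := sval (cid (sym_inv_ex f)).

Let sym_mulA : associative sym_mul.
Proof. by move=> f g h; exact: sym_ext. Qed.
Let sym_mul1 : left_id sym_one sym_mul.
Proof. by move=> f; exact: sym_ext. Qed.
Let sym_mulr1 : right_id sym_one sym_mul.
Proof. by move=> f; exact: sym_ext. Qed.
Let sym_mulV : left_inverse sym_one sym_inv sym_mul.
Proof.
by move=> f; apply: sym_ext => x; rewrite /sym_inv; case: cid => g [] fK gK; exact: fK.
Qed.
Let sym_mulrV : right_inverse sym_one sym_inv sym_mul.
Proof.
by move=> f; apply: sym_ext => x; rewrite /sym_inv; case: cid => g [] fK gK; exact: gK.
Qed.

HB.instance Definition _ :=
  isGroup.Build (sym X) sym_mulA sym_mul1 sym_mulr1 sym_mulV sym_mulrV.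

Lemma symM (f g : sym X) x : (f * g : sym X) x = f (g x). Proof. by []. Qed.
Lemma sym1 x : (1 : sym X) x = x. Proof. by []. Qed.
Lemma symK (f : sym X) : cancel f (f^-1%g : sym X).
Proof. by move=> x; rewrite -symM mulVg. Qed.
Lemma symVK (f : sym X) : cancel (f^-1%g : sym X) f.
Proof. by move=> x; rewrite -symM mulgV. Qed.

End SymmetricGroup.

Definition is_subgroup (G : groupType) (H : set G) :=
  [/\ H 1, (forall x y, H x -> H y -> H (x * y)) & (forall x, H x -> H x^-1)].

Record normal_subgroup (G : groupType) := NormalSubgroup {
  nsubset : set G;
  nsubset_subgroup : is_subgroup nsubset;
  nsubset_conj : forall x y, nsubset x -> nsubset (y * x * y^-1) }.

Section Quotient.
Variables (G : groupType) (N : normal_subgroup G).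

Definition coset_rel : rel G := fun x y => `[< nsubset N (x^-1 * y) >].

Let coset_refl : reflexive coset_rel.
Proof.
by move=> x; apply/asboolP; rewrite mulVg; case: (nsubset_subgroup N).
Qed.
Let coset_sym : symmetric coset_rel.
Proof.
have [_ _ NV] := nsubset_subgroup N.
by move=> x y; apply/asboolP/asboolP => /NV; rewrite invgM invgK.
Qed.
Let coset_trans : transitive coset_rel.
Proof.
have [_ NM _] := nsubset_subgroup N.
move=> y x z /asboolP xy /asboolP yz; apply/asboolP.
by have := NM _ _ xy yz; rewrite mulgA mulgK.
Qed.
Canonical coset_equiv := EquivRel coset_rel coset_refl coset_sym coset_trans.

Definition quot := {eq_quot coset_equiv}.
HB.instance Definition _ := Choice.on quot.
HB.instance Definition _ := EqQuotient.on quot.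

Definition qproj (x : G) : quot := \pi x.

Lemma qprojP x y : qproj x = qproj y <-> nsubset N (x^-1 * y).
Proof.
split=> [/eqmodP/asboolP//|Nxy].
by apply/eqmodP/asboolP.
Qed.

Definition quot_one : quot := qproj 1.
Definition quot_mul (x y : quot) : quot := qproj (repr x * repr y).
Definition quot_inv (x : quot) : quot := qproj (repr x)^-1.

Lemma qproj_repr x : qproj (repr x) = x.
Proof. by rewrite /qproj reprK. Qed.

Let conjN x y : nsubset N x -> nsubset N (y^-1 * x * y).
Proof. by move=> /(@nsubset_conj _ N x y^-1); rewrite invgK. Qed.

Let qprojM x y : quot_mul (qproj x) (qproj y) = qproj (x * y).
Proof.
have [_ NM _] := nsubset_subgroup N.
have /qprojP := qproj_repr (qproj x); set x' := repr _ => hx.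
have /qprojP := qproj_repr (qproj y); set y' := repr _ => hy.
apply/qprojP; rewrite invgM.
have := NM _ _ (conjN y' hx) hy.
by rewrite !mulgA mulgK.
Qed.

Let qprojV x : quot_inv (qproj x) = qproj x^-1.
Proof.
have [_ NM NV] := nsubset_subgroup N.
have /qprojP := qproj_repr (qproj x); set x' := repr _ => hx.
apply/qprojP; rewrite invgK.
have := conjN x^-1 (NV _ hx).
by rewrite invgK invgM invgK !mulgA mulgV mul1g.
Qed.

Let quot_mulA : associative quot_mul.
Proof.
move=> x y z; rewrite -(qproj_repr x) -(qproj_repr y) -(qproj_repr z).
by rewrite !qprojM mulgA.
Qed.
Let quot_mul1 : left_id quot_one quot_mul.
Proof. by move=> x; rewrite -(qproj_repr x) qprojM mul1g. Qed.
Let quot_mulr1 : right_id quot_one quot_mul.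
Proof. by move=> x; rewrite -(qproj_repr x) qprojM mulg1. Qed.
Let quot_mulV : left_inverse quot_one quot_inv quot_mul.
Proof. by move=> x; rewrite -(qproj_repr x) qprojV qprojM mulVg. Qed.
Let quot_mulrV : right_inverse quot_one quot_inv quot_mul.
Proof. by move=> x; rewrite -(qproj_repr x) qprojV qprojM mulgV. Qed.

HB.instance Definition _ :=
  isGroup.Build quot quot_mulA quot_mul1 quot_mulr1 quot_mulV quot_mulrV.

Lemma qproj_morph : {morph qproj : x y / x / y}.
Proof. by move=> x y; rewrite -qprojM -qprojV. Qed.

HB.instance Definition _ := isGroupMorphism.Build G quot qproj qproj_morph.

End Quotient.

Record language := Language {
  funcsym : Type; farity : funcsym -> nat;
  relsym : Type; rarity : relsym -> nat }.

Section Syntax.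
Variable L : language.

Inductive term (V : Type) : Type :=
| Var of V
| App (f : funcsym L) of ('I_(farity f) -> term V).

(* [formula V]: formulas with free variables in V.  In [All phi] the bound
   variable is the variable [None] of phi. *)
Inductive formula (V : Type) : Type :=
| Bot
| Eqn of term V & term V
| Rel (r : relsym L) of ('I_(rarity r) -> term V)
| Imp of formula V & formula V
| All of formula (option V).

Definition fnot V (phi : formula V) := Imp phi (Bot V).
Definition ftrue V := fnot (Bot V).
Definition fand V (phi psi : formula V) := fnot (Imp phi (fnot psi)).

Fixpoint rename_term V W (h : V -> W) (t : term V) : term W :=
  match t with
  | Var v => Var (h v)
  | App f ts => App (fun i => rename_term h (ts i))
  end.

Fixpoint rename V W (h : V -> W) (phi : formula V) : formula W :=
  match phi with
  | Bot => Bot W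
  | Eqn s t => Eqn (rename_term h s) (rename_term h t)
  | Rel r ts => Rel (fun i => rename_term h (ts i))
  | Imp phi psi => Imp (rename h phi) (rename h psi)
  | All phi => All (rename (omap h) phi)
  end.

Record str_on (X : Type) := StrOn {
  fun_interp : forall f : funcsym L, ('I_(farity f) -> X) -> X;
  rel_interp : forall r : relsym L, ('I_(rarity r) -> X) -> Prop;
  str_inhabited : inhabited X }.

Record structure := Structure { carrier :> Type; str : str_on carrier }.

Definition ocons X V (x : X) (v : V -> X) (o : option V) : X :=
  if o is Some y then v y else x.

Fixpoint eval X (s : str_on X) V (v : V -> X) (t : term V) : X :=
  match t with
  | Var y => v y
  | App f ts => fun_interp s (fun i => eval s v (ts i))
  end.

Fixpoint sat X (s : str_on X) V (v : V -> X) (phi : formula V) : Prop :=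
  match phi with
  | Bot => False
  | Eqn t u => eval s v t = eval s v u
  | Rel r ts => rel_interp s (fun i => eval s v (ts i))
  | Imp phi psi => sat s v phi -> sat s v psi
  | All phi => forall x, sat s (ocons x v) phi
  end.

Definition sentence := formula void.
Definition sentence_true (M : structure) (phi : sentence) :=
  sat (str M) (@of_void M) phi.

Definition theory := set sentence.
Definition model_of (T : theory) (M : structure) :=
  forall phi, T phi -> sentence_true M phi.
Definition entails (T : theory) (phi : sentence) :=
  forall M, model_of T M -> sentence_true M phi.
Definition complete_theory (T : theory) :=
  (exists M, model_of T M) /\ forall phi, entails T phi \/ entails T (fnot phi).

Definition strong_hom X Y (s : str_on X) (s' : str_on Y) (h : X -> Y) :=
  (forall f args, h (@fun_interp _ s f args) = fun_interp s' (h \o args)) /\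
  (forall r args, @rel_interp _ s r args <-> rel_interp s' (h \o args)).

Definition elementary X Y (s : str_on X) (s' : str_on Y) (h : X -> Y) :=
  forall V (v : V -> X) (phi : formula V), sat s v phi <-> sat s' (h \o v) phi.

Lemma omap_ocons X V W (h : V -> W) (x : X) (v : W -> X) :
  ocons x v \o omap h = ocons x (v \o h).
Proof. by apply/funext => -[]. Qed.

Lemma eval_rename X (s : str_on X) V W (h : V -> W) (v : W -> X) t :
  eval s v (rename_term h t) = eval s (v \o h) t.
Proof.
by elim: t => //= f ts IH; congr fun_interp; apply/funext => i; exact: IH.
Qed.

Lemma sat_rename X (s : str_on X) V W (h : V -> W) (v : W -> X) phi :
  sat s v (rename h phi) <-> sat s (v \o h) phi.
Proof.
elim: phi W h v => {V} [V|V t u|V r ts|V phi IH1 psi IH2|V phi IH] W h v //=.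
- by rewrite !eval_rename.
- rewrite (_ : (fun i => _) = fun i => eval s (v \o h) (ts i))//.
  by apply/funext => i; rewrite eval_rename.
- by rewrite IH1 IH2.
- by split=> + x => /(_ x); rewrite IH omap_ocons.
Qed.

Lemma eval_hom X Y (s : str_on X) (s' : str_on Y) (h : X -> Y) V (v : V -> X) t :
  strong_hom s s' h -> h (eval s v t) = eval s' (h \o v) t.
Proof.
move=> [hf _]; elim: t => //= f ts IH.
by rewrite hf; congr fun_interp; apply/funext => i; exact: IH.
Qed.

Lemma sat_iso X Y (s : str_on X) (s' : str_on Y) (h : X -> Y) :
  strong_hom s s' h -> bijective h -> elementary s s' h.
Proof.
move=> hh [k hk kh] V v phi; have hi : injective h by exact: can_inj hk.
elim: phi v => {V} [V|V t u|V r ts|V phi IH1 psi IH2|V phi IH] v //=.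
- by rewrite -!(eval_hom _ _ hh); split=> [->//|/hi].
- rewrite (hh.2 r); rewrite (_ : h \o _ = fun i => eval s' (h \o v) (ts i))//.
  by apply/funext => i /=; rewrite (eval_hom _ _ hh).
- by rewrite IH1 IH2.
- have E x : h \o ocons x v = ocons (h x) (h \o v) by apply/funext => -[].
  split=> [H y|H x]; last by apply/IH; rewrite E.
  by have /IH := H (k y); rewrite E kh.
Qed.

End Syntax.

(* The assignment on a disjoint union of variables; [J] is typically a set of
   parameters, regarded as extra free variables interpreted by themselves. *)
Definition joint X I J (u : I -> X) (v : J -> X) (k : I + J) : X :=
  match k with inl i => u i | inr j => v j end.

Definition small (kappa : Type) X (A : set X) :=
  ([set: kappa] #>= A)%card /\ ~ ([set: kappa] #<= A)%card.

Section Monster.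
Variables (L : language) (M : structure L).

Definition is_aut (f : sym M) := strong_hom (str M) (str M) f.

Record aut := Aut { aut_sym :> sym M; aut_symP : `[< is_aut aut_sym >] }.

Section Types.
Variables (I : Type) (A : set M).

Definition realizes (p : set (formula L (I + A))) (u : I -> M) :=
  forall phi, p phi -> sat (str M) (joint u val) phi.

Definition finitely_satisfiable (p : set (formula L (I + A))) :=
  forall q, q `<=` p -> finite_set q -> exists u, realizes q u.

Definition complete_type (p : set (formula L (I + A))) :=
  finitely_satisfiable p /\ forall phi, p phi \/ p (fnot phi).
End Types.

Definition saturated (kappa : Type) := forall A : set M, small kappa A ->
  forall p : set (formula L (unit + A)), finitely_satisfiable p ->
  exists u, realizes p u.

Definition strongly_homogeneous (kappa : Type) := forall A : set M, small kappa A ->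
  forall g : A -> M,
    (forall phi : formula L A, sat (str M) val phi <-> sat (str M) g phi) ->
  exists f : sym M, is_aut f /\ forall x : A, f (val x) = g x.

(* The smallness conditions say that |L| + aleph_0 < kappa. *)
Definition monster (T : theory L) (kappa : Type) :=
  [/\ model_of T M,
      small kappa [set: nat], small kappa [set: funcsym L], small kappa [set: relsym L]
    & saturated kappa /\ strongly_homogeneous kappa].

Definition elementary_substructure (A : set M) :=
  exists s : str_on L A, strong_hom s (str M) val /\ elementary s (str M) val.

End Monster.

Section Automorphisms.
Variables (L : language) (M : structure L).

Definition aut_pred : pred (sym M) := fun f => `[< is_aut f >].

HB.instance Definition _ := [isSub for @aut_sym L M].
HB.instance Definition _ := [Choice of aut M by <:].

Lemma aut_closed : group_closed aut_pred.
Proof.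
split=> [|f g /asboolP[ff fr] /asboolP[gf gr]]; first exact/asboolP.
have gK T (args : T -> M) : g \o ((g^-1%g : sym M) \o args) = args.
  by apply/funext => x; exact: symVK.
apply/asboolP; split=> [s args|r args]; set args' := (g^-1%g : sym M) \o args.
- have E : fun_interp (str M) args = g (fun_interp (str M) args').
    by rewrite gf /args' gK.
  by rewrite E symM symK ff.
- rewrite (_ : (f / g : sym M) \o args = f \o args')//.
  by rewrite -fr (gr r args') /args' gK.
Qed.

HB.instance Definition _ :=
  SubChoice_isSubGroup.Build (sym M) aut_pred (aut M) aut_closed.

Lemma aut_is_aut (f : aut M) : is_aut f.
Proof. exact/asboolP/aut_symP. Qed.

Lemma autM (f g : aut M) x : (f * g : aut M) x = f (g x). Proof. by []. Qed.
Lemma aut1 x : (1 : aut M) x = x. Proof. by []. Qed.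
Lemma autK (f : aut M) : cancel f (f^-1%g : aut M).
Proof. by move=> x; rewrite -autM mulVg. Qed.
Lemma autVK (f : aut M) : cancel (f^-1%g : aut M) f.
Proof. by move=> x; rewrite -autM mulgV. Qed.

Lemma sat_aut (f : aut M) V (v : V -> M) phi :
  sat (str M) v phi <-> sat (str M) (f \o v) phi.
Proof. by apply: sat_iso; [exact: aut_is_aut|exact: sym_bij]. Qed.

Lemma elementary_substructure_aut (f : aut M) (A : set M) :
  elementary_substructure A -> elementary_substructure (f @` A).
Proof.
move=> [s [sh se]].
pose h (x : A) : f @` A :=
  exist _ (f (val x)) (mem_set (ex_intro2 _ _ _ (set_mem (valP x)) erefl)).
have kP (y : f @` A) : exists x : A, h x = y.
  case: y => y yA; have [x Ax xy] := set_mem yA.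
  by exists (exist _ x (mem_set Ax)); apply: val_inj.
pose k y := sval (cid (kP y)).
have kK y : h (k y) = y by rewrite /k; case: cid.
have hK x : k (h x) = x.
  have /(congr1 val) /= := kK (h x).
  by move=> /(can_inj (autK f)) /val_inj.
have hb : bijective h by exists k.
pose s' : str_on L (f @` A) := StrOn
  (fun g args => h (fun_interp s (k \o args)))
  (fun r args => rel_interp s (k \o args))
  (let: inhabits x := str_inhabited s in inhabits (h x)).
have hh : strong_hom s s' h.
  have E T (args : T -> A) : k \o (h \o args) = args.
    by apply/funext => i /=; rewrite hK.
  by split=> [g args|r args] /=; rewrite E.
have vE T (args : T -> f @` A) : val \o args = f \o (val \o (k \o args)).
  by apply/funext => i /=; rewrite -{1}(kK (args i)).
exists s'; split; first split=> [g args|r args].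
- rewrite vE /= -[LHS]/(f (val (fun_interp s (k \o args)))).
  by rewrite sh.1 (aut_is_aut f).1.
- rewrite vE -(aut_is_aut f).2 /=.
  exact: (sh.2 r (k \o args)).
- move=> V v phi; rewrite vE -sat_aut -se.
  rewrite (sat_iso hh hb) (_ : h \o _ = v)//.
  by apply/funext => x /=; rewrite kK.
Qed.

End Automorphisms.

Section Hyperimaginaries.
Variables (L : language) (M : structure L).

Record td_equiv := TDEquiv {
  tidx : Type;
  tdrel : (tidx -> M) -> (tidx -> M) -> Prop;
  td_refl : forall u, tdrel u u;
  td_sym : forall u v, tdrel u v -> tdrel v u;
  td_trans : forall u v w, tdrel u v -> tdrel v w -> tdrel u w;
  td_def : exists p : set (formula L (tidx + tidx)), forall u v,
    tdrel u v <-> forall phi, p phi -> sat (str M) (joint u v) phi }.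
Arguments tdrel : clear implicits.

Lemma tdrel_aut (F : td_equiv) (f : aut M) u v :
  tdrel F (f \o u) (f \o v) <-> tdrel F u v.
Proof.
have [p pP] := td_def F.
have E : joint (f \o u) (f \o v) = f \o joint u v by apply/funext => -[].
by rewrite !pP E; split=> H phi /H; rewrite -sat_aut.
Qed.

Record himag (F : td_equiv) := Himag {
  hclass : set (tidx F -> M);
  hclassP : exists a, hclass = tdrel F a }.

Lemma himag_ext F (x y : himag F) : hclass x = hclass y -> x = y.
Proof.
case: x y => [x px] [y py] /= e; subst y.
by congr Himag; exact: Prop_irrelevance.
Qed.

Definition hcls F (a : tidx F -> M) : himag F :=
  Himag (ex_intro _ a (erefl (tdrel F a))).

Lemma hclass_aut F (f : aut M) (x : himag F) :
  exists a, [set f \o u | u in hclass x] = tdrel F a.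
Proof.
have [a ->] := hclassP x; exists (f \o a).
apply/seteqP; split=> [_ [u au <-]|u fau]; first by apply/tdrel_aut.
exists ((f^-1%g : aut M) \o u); last by apply/funext => i /=; exact: autVK.
apply/(tdrel_aut f a); rewrite (_ : f \o (_ \o u) = u)//.
by apply/funext => i /=; exact: autVK.
Qed.

Definition hact F (f : aut M) (x : himag F) : himag F := Himag (hclass_aut f x).

Lemma hact1 F (x : himag F) : hact 1 x = x.
Proof.
by apply: himag_ext; apply/seteqP; split=> [_ [u ? <-]//|u ?]; exists u.
Qed.

Lemma hactM F (f g : aut M) (x : himag F) : hact (f * g) x = hact f (hact g x).
Proof.
apply: himag_ext; apply/seteqP; split=> [_ [u xu <-]|_ [_ [u xu <-] <-]].
  by exists (g \o u) => //; exists u.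
by exists u.
Qed.

Lemma hactK F (f : aut M) : cancel (@hact F f) (hact f^-1).
Proof. by move=> x; rewrite -hactM mulVg hact1. Qed.

Lemma hactVK F (f : aut M) : cancel (@hact F f^-1) (hact f).
Proof. by move=> x; rewrite -hactM mulgV hact1. Qed.

Section Pairing.
Variables F G : td_equiv.

Definition pair_rel (u v : tidx F + tidx G -> M) :=
  tdrel F (u \o inl) (v \o inl) /\ tdrel G (u \o inr) (v \o inr).

Lemma pair_refl u : pair_rel u u.
Proof. by split; exact: td_refl. Qed.
Lemma pair_sym u v : pair_rel u v -> pair_rel v u.
Proof. by case=> ? ?; split; exact: td_sym. Qed.
Lemma pair_trans u v w : pair_rel u v -> pair_rel v w -> pair_rel u w.
Proof. by move=> [a b] [c d]; split; [exact: td_trans a c|exact: td_trans b d]. Qed.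

Lemma pair_def :
  exists p : set (formula L ((tidx F + tidx G) + (tidx F + tidx G))),
  forall u v,
  pair_rel u v <-> forall phi, p phi -> sat (str M) (joint u v) phi.
Proof.
have [p pP] := td_def F; have [q qP] := td_def G.
pose l (k : tidx F + tidx F) : (tidx F + tidx G) + (tidx F + tidx G) :=
  match k with inl i => inl (inl i) | inr i => inr (inl i) end.
pose r (k : tidx G + tidx G) : (tidx F + tidx G) + (tidx F + tidx G) :=
  match k with inl i => inl (inr i) | inr i => inr (inr i) end.
exists ([set rename l phi | phi in p] `|` [set rename r phi | phi in q]) => u v.
have El : joint u v \o l = joint (u \o inl) (v \o inl) by apply/funext => -[].
have Er : joint u v \o r = joint (u \o inr) (v \o inr) by apply/funext => -[].
split=> [[/pP Hp /qP Hq] _ [] [phi h <-]|H].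
- by rewrite sat_rename El; exact: Hp.
- by rewrite sat_rename Er; exact: Hq.
split; [apply/pP|apply/qP] => phi h.
- by rewrite -El -sat_rename; apply: H; left; exists phi.
- by rewrite -Er -sat_rename; apply: H; right; exists phi.
Qed.

Definition td_pair : td_equiv :=
  TDEquiv pair_refl pair_sym pair_trans pair_def.

Lemma hpair_subproof (x : himag F) (y : himag G) :
  exists a, [set u : tidx td_pair -> M |
    hclass x (u \o inl) /\ hclass y (u \o inr)] = tdrel td_pair a.
Proof.
by have [a ->] := hclassP x; have [b ->] := hclassP y; exists (joint a b).
Qed.

Definition hpair (x : himag F) (y : himag G) : himag td_pair :=
  Himag (hpair_subproof x y).

Lemma hpair_inj x y x' y' : hpair x y = hpair x' y' -> x = x' /\ y = y'.
Proof.
move=> /(congr1 (@hclass _)) /= E.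
have E' u v : hclass x u /\ hclass y v <-> hclass x' u /\ hclass y' v.
  by have /(congr1 (@^~ (joint u v))) /= := E; move=> ->.
have [a xa] := hclassP x; have [b yb] := hclassP y.
have [a' xa'] := hclassP x'; have [b' yb'] := hclassP y'.
have := (E' a b).1; rewrite {1}xa {1}yb => /(_ (conj (td_refl a) (td_refl b))).
move=> [x'a y'b]; split; apply: himag_ext; apply/seteqP.
  split=> u xu; first by have [] := (E' u b).1 (conj xu (eq_ind_r (@^~ b) (td_refl b) yb)).
  by have [] := (E' u b).2 (conj xu y'b).
split=> u yu; first by have [] := (E' a u).1 (conj (eq_ind_r (@^~ a) (td_refl a) xa) yu).
by have [] := (E' a u).2 (conj x'a yu).
Qed.

Lemma hact_pair (f : aut M) x y : hact f (hpair x y) = hpair (hact f x) (hact f y).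
Proof.
apply: himag_ext; apply/seteqP; split=> [_ [u [xu yu] <-]|u [/= [v xv vu] [w yw wu]]].
  by split; [exists (u \o inl)|exists (u \o inr)].
exists (joint v w) => //; apply/funext => -[i|i] /=.
  exact: (congr1 (@^~ i) vu).
exact: (congr1 (@^~ i) wu).
Qed.

End Pairing.

Definition acl_over F G E (c : himag F) (b : himag G) (e : himag E) :=
  finite_set [set hact f c | f in [set f : aut M | hact f b = b /\ hact f e = e]].

Definition in_dcl E (e : himag E) (A : set M) :=
  forall f : aut M, (forall x, A x -> f x = x) -> hact f e = e.

End Hyperimaginaries.

Arguments tdrel {L M} _ _ _.

Lemma small_image (kappa X Y : Type) (A : set X) (f : X -> Y) :
  small kappa A -> small kappa [set f x | x in A].
Proof.
have fA : ([set f x | x in A] #<= A)%card by exact: card_image_le.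
move=> [AK nKA]; split; first exact: card_le_trans AK.
by apply: contra_not nKA => /card_le_trans; apply.
Qed.

Section Stone.
Variables (L : language) (M : structure L) (I : Type) (A : set M).

HB.instance Definition _ V := gen_eqMixin (formula L V).
HB.instance Definition _ V := gen_choiceMixin (formula L V).
HB.instance Definition _ V := isPointed.Build (formula L V) (ftrue L V).

Record stone := Stone {
  stype : set (formula L (I + A));
  stypeP : complete_type stype }.

HB.instance Definition _ := gen_eqMixin stone.
HB.instance Definition _ := gen_choiceMixin stone.

Lemma stype_entails (p : stone) q phi :
  q `<=` stype p -> finite_set q ->
  (forall u, realizes q u -> sat (str M) (joint u val) phi) -> stype p phi.
Proof.
move=> qp fq qphi; have [fs /(_ phi) [//|np]] := stypeP p.
have [||u ru] := fs (q `|` [set fnot phi]).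
- by move=> psi [/qp//|->].
- by rewrite finite_setU.
have /qphi h : realizes q u by move=> psi qpsi; apply: ru; left.
by have := ru (fnot phi) (or_intror erefl) h.
Qed.

Definition basic_open (phi : formula L (I + A)) : set stone :=
  [set p | stype p phi].

Let basic_cover : \bigcup_(phi in setT) basic_open phi = setT.
Proof.
apply/seteqP; split=> // p _; exists (ftrue L _) => //.
by apply: (@stype_entails p set0) => //= u _.
Qed.

Let basic_join phi psi p : setT phi -> setT psi ->
  basic_open phi p -> basic_open psi p ->
  exists chi, [/\ setT chi, basic_open chi p &
    basic_open chi `<=` basic_open phi `&` basic_open psi].
Proof.
move=> _ _ pphi ppsi; exists (fand phi psi); split=> //.
  apply: (@stype_entails p [set phi; psi]) => [_ [] ->//||u ru /= H].
    by rewrite finite_setU.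
  by apply: H; apply: ru; [left|right].
move=> r rand; split; apply: (@stype_entails r [set fand phi psi]) => [_ ->//||u];
  do ?exact: finite_set1; move=> /(_ _ erefl) /= H.
  by apply: contrapT => nphi; apply: H => /nphi.
by apply: contrapT => npsi; apply: H.
Qed.

HB.instance Definition _ := isBaseTopological.Build stone basic_cover basic_join.

Lemma tp_complete (u : I -> M) :
  complete_type [set phi : formula L (I + A) | sat (str M) (joint u val) phi].
Proof.
split=> [q qu _|phi]; first by exists u.
by case: (pselect (sat (str M) (joint u val) phi)) => h; [left|right].
Qed.

Definition tp (u : I -> M) : stone := Stone (tp_complete u).

End Stone.

Section LascarGroup.
Variables (L : language) (M : structure L) (kappa : Type).
Variables (E : td_equiv M) (e : himag E).

Record autE := AutE { autE_aut :> aut M; autE_fix : `[< hact autE_aut e = e >] }.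

Definition autE_pred : pred (aut M) := fun f => `[< hact f e = e >].

HB.instance Definition _ := [isSub for @autE_aut].
HB.instance Definition _ := [Choice of autE by <:].

Lemma autE_closed : group_closed autE_pred.
Proof.
split=> [|f g /asboolP fe /asboolP ge]; first exact/asboolP/hact1.
by apply/asboolP; rewrite hactM -{1}ge hactK.
Qed.

HB.instance Definition _ :=
  SubChoice_isSubGroup.Build (aut M) autE_pred autE autE_closed.

Lemma autEP (f : autE) : hact f e = e.
Proof. exact/asboolP/autE_fix. Qed.

Lemma autE_actM F (f g : autE) (x : himag F) :
  hact (f * g : autE) x = hact f (hact g x).
Proof. exact: hactM. Qed.
Lemma autE_act1 F (x : himag F) : hact (1 : autE) x = x.
Proof. exact: hact1. Qed.
Lemma autE_actK F (f : autE) : cancel (@hact _ _ F f) (hact (f^-1 : autE)).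
Proof. exact: hactK. Qed.
Lemma autE_actVK F (f : autE) : cancel (@hact _ _ F (f^-1 : autE)) (hact f).
Proof. exact: hactVK. Qed.

Record small_model := SmallModel {
  smodel : set M;
  smodel_small : small kappa smodel;
  smodel_elem : elementary_substructure smodel;
  smodel_dcl : in_dcl e smodel }.

Definition autf_generators : set autE :=
  [set f | exists N, forall x, smodel N x -> f x = x].

Definition autf_set : set autE := smallest (@is_subgroup autE) autf_generators.

Lemma autf_subgroup : is_subgroup autf_set.
Proof.
split=> [H [[]]//|x y fx fy H [sH gH]|x fx H [sH gH]]; have [_ HM HV] := sH.
  by apply: HM; [apply: fx|apply: fy].
by apply: HV; apply: fx.
Qed.

Lemma smodel_conj_dcl (g : autE) (N : small_model) : in_dcl e (g @` smodel N).
Proof.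
move=> f fN; have ge := autEP g.
pose h : aut M := g; change (hact h e = e) in ge.
have /smodel_dcl : forall x, smodel N x -> (h^-1 * f * h : aut M) x = x.
  move=> x Nx; rewrite -[LHS]/((h^-1%g : aut M) (f (h x))).
  by rewrite fN ?autK//; exists x.
rewrite !hactM ge => /(congr1 (hact h)).
by rewrite hactVK ge.
Qed.

Definition smodel_conj (g : autE) (N : small_model) : small_model :=
  SmallModel (small_image g (smodel_small N))
    (elementary_substructure_aut g (smodel_elem N)) (@smodel_conj_dcl g N).

Lemma autf_conj (f g : autE) : autf_set f -> autf_set (g * f * g^-1).
Proof.
have [f1 fM fV] := autf_subgroup.
pose H : set autE := [set f | autf_set (g * f * g^-1)].
move=> /(_ H); apply; split; first split=> [|x y|x].
- by rewrite /H /= mulg1 mulgV.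
- move=> /fM Hx /Hx; rewrite /H /=.
  by rewrite !mulgA mulgVK.
- by move=> /fV; rewrite /H /= !invgM invgK mulgA.
move=> x [N xN]; apply: sub_gen_smallest; exists (smodel_conj g N).
move=> _ [y Ny <-]; rewrite -[LHS]/(g (x ((g^-1%g : autE) (g y)))).
by rewrite -[X in x X]/((g^-1 * g : autE) y) mulVg xN.
Qed.

Definition autf : normal_subgroup autE := NormalSubgroup autf_subgroup autf_conj.

Definition lascar_eq F (u v : himag F) :=
  exists f, autf_set f /\ hact f u = v.

Definition gal := quot autf.

Definition gal_top (N1 N2 : small_model) : Type := gal.
HB.instance Definition _ N1 N2 := Choice.on (gal_top N1 N2).

(* The topology of gal, as the quotient topology under nu : S_M(N) -> gal,
   tp(f(M)/N) |-> the class of f, for small models M and N.  In a monster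
   model this class only depends on p = tp(f(M)/N), so nu may choose any such f;
   values outside S_M(N) are irrelevant for the subspace topology. *)
Section Topology.
Variables N1 N2 : small_model.

Definition tp_model (f : autE) : stone (smodel N1) (smodel N2) :=
  tp (smodel N2) (f \o (val : smodel N1 -> M)).

Definition stone_model : set (stone (smodel N1) (smodel N2)) :=
  [set tp_model f | f in setT].

Definition nu (p : subspace stone_model) : gal :=
  qproj autf (xget 1 [set f | tp_model f = p]).

Definition gal_open : set (set (gal_top N1 N2)) := [set U | open (nu @^-1` U)].

Let gal_openT : gal_open setT.
Proof. exact: openT. Qed.
Let gal_openI : setI_closed gal_open.
Proof. by move=> U V; exact: openI. Qed.
Let gal_open_bigcup (J : Type) (f : J -> set (gal_top N1 N2)) :
  (forall j, gal_open (f j)) -> gal_open (\bigcup_j f j).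
Proof.
by move=> fo; rewrite /gal_open /= preimage_bigcup; apply: bigcup_open => j _; exact: fo.
Qed.

HB.instance Definition _ :=
  isOpenTopological.Build (gal_top N1 N2) gal_openT gal_openI gal_open_bigcup.

End Topology.

(* The topology does not depend on the choice of small models. *)
Definition G_compact :=
  exists N1 N2, closed ([set (1 : gal)] : set (gal_top N1 N2)).

Lemma lascar_eq_refl F (u : himag F) : lascar_eq u u.
Proof. by exists 1; split; [case: autf_subgroup|exact: autE_act1]. Qed.

Lemma lascar_eq_sym F (u v : himag F) : lascar_eq u v -> lascar_eq v u.
Proof.
have [_ _ fV] := autf_subgroup.
by move=> [f [/fV f' <-]]; exists f^-1; split=> //; exact: autE_actK.
Qed.

Lemma lascar_eq_trans F (u v w : himag F) :
  lascar_eq u v -> lascar_eq v w -> lascar_eq u w.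
Proof.
have [_ fM _] := autf_subgroup.
move=> [f [ff <-]] [g [fg <-]]; exists (g * f); split; first exact: fM.
exact: autE_actM.
Qed.

Lemma lascar_eq_act F (g : autE) (u v : himag F) :
  lascar_eq u v -> lascar_eq (hact g u) (hact g v).
Proof.
move=> [f [ff <-]]; exists (g * f * g^-1); split; first exact: autf_conj.
by rewrite !autE_actM autE_actK.
Qed.

Section Relativized.
Variables (D : td_equiv M) (d : himag D).

Definition realization : set (himag D) := [set hact f d | f in [set: autE]].

Lemma realization_act (f : autE) (x : realization) :
  hact f (val x) \in realization.
Proof.
apply/mem_set; have [g _ gx] := set_mem (valP x).
by exists (f * g) => //; rewrite autE_actM gx.
Qed.

Definition act_real (f : autE) (x : realization) : realization :=
  exist _ (hact f (val x)) (realization_act f x).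

Lemma act_real_bij f : bijective (act_real f).
Proof.
exists (act_real f^-1) => x; apply: val_inj => /=.
  exact: autE_actK.
exact: autE_actVK.
Qed.

Definition restr_sym (f : autE) : sym realization := Sym (act_real_bij f).

Lemma restr_symM : {morph restr_sym : f g / f * g}.
Proof. by move=> f g; apply: sym_ext => x; apply: val_inj; exact: autE_actM. Qed.

Lemma restr_symF : {morph restr_sym : f g / f / g}.
Proof.
by move=> f g; rewrite -[in RHS](mulgVK g f) [in RHS]restr_symM mulgK.
Qed.

HB.instance Definition _ :=
  isGroupMorphism.Build autE (sym realization) restr_sym restr_symF.

Definition autq_pred : pred (sym realization) :=
  fun g => `[< exists f, g = restr_sym f >].

Record autq := AutQ { autq_sym :> sym realization; autqP : autq_pred autq_sym }.

HB.instance Definition _ := [isSub for @autq_sym].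
HB.instance Definition _ := [Choice of autq by <:].

Lemma autq_closed : group_closed autq_pred.
Proof.
split=> [|g h /asboolP[f ->] /asboolP[k ->]]; apply/asboolP.
  by exists 1; rewrite gmulf1.
by exists (f / k); rewrite gmulfF.
Qed.

HB.instance Definition _ :=
  SubChoice_isSubGroup.Build (sym realization) autq_pred autq autq_closed.

Lemma restr_subproof (f : autE) : autq_pred (restr_sym f).
Proof. by apply/asboolP; exists f. Qed.

Definition restr (f : autE) : autq := AutQ (restr_subproof f).

Lemma restrE (f : autE) x : val (restr f x) = hact f (val x). Proof. by []. Qed.

Lemma restrF : {morph restr : f g / f / g}.
Proof. by move=> f g; apply: val_inj; exact: restr_symF. Qed.

HB.instance Definition _ := isGroupMorphism.Build autE autq restr restrF.

Lemma restr_surj (g : autq) : exists f, restr f = g.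
Proof. by have /asboolP[f fg] := autqP g; exists f; apply: val_inj. Qed.

Definition autf1_set : set autq :=
  [set g | forall x : realization, lascar_eq (val x) (val (g x))].

Lemma autf1_subgroup : is_subgroup autf1_set.
Proof.
split=> [x|g h gf hf x|g gf x]; first exact: lascar_eq_refl.
  exact: lascar_eq_trans (hf x) (gf (h x)).
have := gf ((g^-1%g : autq) x); rewrite -[X in lascar_eq _ (val X)]/((g * g^-1 : autq) x).
by rewrite mulgV => /lascar_eq_sym.
Qed.

Lemma autf1_conj (g h : autq) : autf1_set g -> autf1_set (h * g * h^-1).
Proof.
move=> gf x; have [f fh] := restr_surj h.
have := lascar_eq_act f (gf ((h^-1%g : autq) x)).
rewrite -!restrE fh.
by rewrite -[X in lascar_eq (val X)]/((h * h^-1 : autq) x) mulgV.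
Qed.

Definition autf1 : normal_subgroup autq :=
  NormalSubgroup autf1_subgroup autf1_conj.

Definition gal1 := quot autf1.

Lemma gal1_surj (x : gal1) : exists f, x = qproj autf1 (restr f).
Proof.
by have [f fx] := restr_surj (repr x); exists f; rewrite fx qproj_repr.
Qed.

End Relativized.

Section Projection.
Variables (F G : td_equiv M) (b : himag F) (c : himag G).

Definition pi1 (x : gal1 (hpair b c)) : gal1 b :=
  qproj (autf1 b) (restr b (sval (cid (gal1_surj x)))).

Lemma pi1E f :
  pi1 (qproj (autf1 (hpair b c)) (restr (hpair b c) f)) =
  qproj (autf1 b) (restr b f).
Proof.
rewrite /pi1; case: cid => g /= /qprojP.
rewrite -gmulfV -gmulfM => gf; apply/qprojP; rewrite -gmulfV -gmulfM.
set h : autE := (f^-1 * g) in gf *.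
have [_ _ NV] := autf1_subgroup b.
rewrite (_ : (g^-1 * f : autE) = h^-1); last by rewrite /h invgM invgK.
rewrite gmulfV; apply: NV => x.
have [k _ kx] := set_mem (valP x).
have yP : hact k (hpair b c) \in realization (hpair b c).
  by apply/mem_set; exists k.
pose y : realization (hpair b c) := exist _ (hact k (hpair b c)) yP.
have [j [jf]] := gf y.
rewrite -[RHS]/(hact h (hact k (hpair b c))) /= !hact_pair.
move=> /hpair_inj[jb _].
by rewrite kx in jb; exists j.
Qed.

Lemma pi1F : {morph pi1 : x y / x / y}.
Proof.
move=> x y; have [f ->] := gal1_surj x; have [g ->] := gal1_surj y.
by rewrite -gmulfF -gmulfF !pi1E gmulfF gmulfF.
Qed.

HB.instance Definition _ :=
  isGroupMorphism.Build (gal1 (hpair b c)) (gal1 b) pi1 pi1F.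

Definition ker_pi1 : set (gal1 (hpair b c)) := [set x | pi1 x = 1].

End Projection.

End LascarGroup.

Arguments hcls {L M} F a.
Arguments hact {L M F} f x.
Arguments autf {L M} kappa {E} e.
Arguments lascar_eq {L M} kappa {E} e {F} u v.
Arguments gal {L M} kappa {E} e.
Arguments G_compact {L M} kappa {E} e.
Arguments realization {L M E} e {D} d.
Arguments autq {L M E} e {D} d.
Arguments autf1 {L M} kappa {E} e {D} d.
Arguments gal1 {L M} kappa {E} e {D} d.
Arguments pi1 {L M kappa E e F G b c} x.
Arguments ker_pi1 {L M} kappa {E} e {F G} b c.

(* Main.v *)
Require Import Defs.
From mathcomp Require Import all_boot.
From mathcomp Require Import boolp classical_sets functions cardinality filter.
From mathcomp Require Import topology_structure subspace_topology.

(** Write Gam for the Lascar group over e, B for the image in Gam of the stabilizer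
    of bc, and C for the image of the stabilizer of b. An automorphism f preserves
    the Lascar class of every realization of tp(bc/e) exactly when all conjugates
    of its image in Gam lie in B, and likewise for b and C ([autf1_stab]). Hence K_1
    is the quotient of the core of C by the core of B, where the core of a subgroup
    is the intersection of its conjugates. Since c is algebraic over be, B has
    finite index in C ([stab_class_index]), but this alone bounds nothing, as B may
    have infinitely many conjugates.

    If T is G-compact over e, then Gam is a compact Hausdorff group in which B is
    closed. In this situation finitely many conjugates of B are enough: an element
    of the core of C that lies in them lies in all conjugates of B
    ([finitely_many_conjugates]). An element of K_1 is therefore determined by the
    cosets of B in C that contain its conjugates by finitely many fixed elements,
    and there are finitely many possibilities for these.

    Compactness of Gam is used in the form of a limit operation on sequences along
    a free ultrafilter on nat ([gal_limit]). Automorphisms are given by their action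
    on a small tuple w that contains two models and representatives of the
    hyperimaginaries; g is a limit of the g_n if the type of g(w) over w is the
    ultralimit of the types of g_n(w) over w. Limits exist by saturation, are unique
    in Gam since w contains a model over which e is definable, and are compatible
    with products by homogeneity. G-compactness says that Autf_e is closed under
    limits, so that the limit is well defined on Gam.

    Saturation and homogeneity are needed for small tuples, whereas saturation is
    given for single elements; [saturated_tuple] makes the passage. Small sets must
    be closed under disjoint unions, which rests on the comparability of cardinals
    and on the equality of an infinite cardinal with its double. *)

Set Implicit Arguments.
Unset Strict Implicit.
Unset Printing Implicit Defensive.

Local Open Scope classical_set_scope.

(** * Small sets are closed under disjoint unions *)

Lemma card_leTP (X Y : Type) :
  ([set: X] #<= [set: Y])%card <-> exists f : X -> Y, injective f.
Proof.
split=> [/card_leP[f]|[f fI]].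
  exists (fun x => val (f (SigSub (mem_set (I : [set: X] x))))) => x y.
  by move=> /val_inj /(@inj _ _ _ f); rewrite !inE => /(_ I I) [].
apply: (@card_le_trans _ _ _ (f @` [set: X])); last exact: card_leT.
have /card_esym : (f @` [set: X] #= [set: X])%card.
  by apply: inj_card_eq => x y _ _; exact: fI.
by rewrite card_eq_le => /andP[].
Qed.

(** Zorn's lemma is used below on families of sets defined by conditions on
    pairs of elements; such conditions pass to unions of chains. *)
Lemma chain_pair (X : Type) (F : set (set X)) x y : total_on F subset ->
  (\bigcup_(S in F) S) x -> (\bigcup_(S in F) S) y ->
  exists S, [/\ F S, S x & S y].
Proof.
move=> Ftot [S FS Sx] [S' FS' S'y].
have [SS'|S'S] := Ftot _ _ FS FS'; first by exists S'; split=> //; exact: SS'.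
by exists S; split=> //; exact: S'S.
Qed.

(** A maximal partial injection from X to Y, seen as a subset of X * Y, exhausts
    X or Y: otherwise one more pair could be added. *)
Lemma card_le_total (X Y : Type) :
  ([set: X] #<= [set: Y])%card \/ ([set: Y] #<= [set: X])%card.
Proof.
pose P (R : set (X * Y)) := forall u v, R u -> R v -> u.1 = v.1 <-> u.2 = v.2.
have [F FP Ftot u v Fu Fv|R [PR Rmax]] := @Zorn_bigcup _ P.
  have [S [FS Su Sv]] := chain_pair Ftot Fu Fv.
  exact: FP FS _ _ Su Sv.
have [domR|] := pselect (forall x, exists y, R (x, y)).
  left; apply/card_leTP; have [f fR] := choice domR; exists f => x x'.
  by move=> /(PR _ _ (fR x) (fR x')).2.
move=> /existsNP[x0 /forallNP x0R].
have [ranR|] := pselect (forall y, exists x, R (x, y)).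
  right; apply/card_leTP; have [f fR] := choice ranR; exists f => y y'.
  by move=> /(PR _ _ (fR y) (fR y')).1.
move=> /existsNP[y0 /forallNP y0R].
exfalso; apply: (Rmax (R `|` [set (x0, y0)])).
  by split=> [u|/(_ (x0, y0) (or_intror erefl)) /x0R//]; left.
move=> u v [Ru|->] [Rv|->] //=; first exact: PR.
- case: u Ru => x y Rxy /=; split=> h; exfalso.
    by apply: (x0R y); rewrite -h.
  by apply: (y0R x); rewrite -h.
- case: v Rv => x y Rxy /=; split=> h; exfalso.
    by apply: (x0R y); rewrite h.
  by apply: (y0R x); rewrite h.
Qed.

(** A maximal family F of injective sequences in B with disjoint ranges leaves
    only finitely many points uncovered, and one member of F can absorb them.
    So every point of B has a code (f, n) with f in F, and sending (x, i), where
    x has code (f, n), to f (2n + i) is injective. *)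
Lemma infinite_double (B : Type) : ([set: nat] #<= [set: B])%card ->
  ([set: B * bool] #<= [set: B])%card.
Proof.
move=> leNB.
pose P (F : set (nat -> B)) :=
  forall f g n m, F f -> F g -> f n = g m -> f = g /\ n = m.
have [C CP Ctot f g n m Cf Cg|F [PF Fmax]] := @Zorn_bigcup _ P.
  have [S [CS Sf Sg]] := chain_pair Ctot Cf Cg.
  exact: (CP _ CS).
pose rest : set B := [set x | forall f n, F f -> f n <> x].
have rest_fin : finite_set rest.
  apply: contrapT => /infiniteP; rewrite -(card_le_eqr (card_setT rest)).
  move=> /card_leTP[i iI]; apply: (Fmax (F `|` [set val \o i])).
    split=> [f|/(_ (val \o i) (or_intror erefl)) Fi]; first by left.
    exact: (set_mem (valP (i 0)) _ 0 Fi).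
  move=> f g n m [Ff|->] [Fg|->] /=; first exact: PF.
  - by move=> h; have := set_mem (valP (i m)) f n Ff h.
  - by move=> h; have := set_mem (valP (i n)) g m Fg (esym h).
  - by move=> /val_inj/iI.
have [f0 Ff0] : F !=set0.
  apply: contrapT => F0; suff restT : rest = setT.
    by move: rest_fin; rewrite restT; apply/infiniteP.
  by apply/seteqP; split=> // x _ f n Ff; case: F0; exists f.
have [l lrest] : exists l : seq {classic B}, rest = [set` l] by exact/finite_seqP.
(* s enumerates the finite rest first and then the range of f0. *)
pose s n := if (n < size l)%N then nth (f0 0) l n else f0 (n - size l)%N.
have codeP x : exists c : (nat -> B) * nat,
    F c.1 /\ (if pselect (c.1 = f0) then s c.2 else c.1 c.2) = x.
  have [|] := pselect (rest x).
    rewrite lrest => lx; exists (f0, index (x : {classic B}) l); split=> //=.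
    by case: pselect => //= _; rewrite /s index_mem lx; exact: (@nth_index {classic B}).
  move=> /existsNP[f /existsNP[n]] /not_implyP[Ff] /contrapT fnx.
  have [ff0|nff0] := pselect (f = f0).
    exists (f0, size l + n)%N; split=> //=; case: pselect => //= _.
    by rewrite /s ltnNge leq_addr /= addKn -ff0.
  by exists (f, n); split=> //=; case: pselect.
have [code codeE] := choice codeP; apply/card_leTP.
exists (fun xb : B * bool => (code xb.1).1 ((code xb.1).2.*2 + xb.2)) => -[x b] [y c] /=.
have [[Fx xE] [Fy yE]] := (codeE x, codeE y).
move=> /(PF _ _ _ _ Fx Fy) [e1 e2].
have bc : b = c.
  by move/(congr1 odd): e2; rewrite !oddD !odd_double !oddb.
move: e2; rewrite bc => /addIn/double_inj e2.
by rewrite -xE -yE e1 e2.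
Qed.

Lemma small_le (kappa X Y : Type) (A : set X) (B : set Y) :
  (A #<= B)%card -> small kappa B -> small kappa A.
Proof.
move=> AB [BK nKB]; split; first exact: card_le_trans BK.
by move=> KA; apply: nKB; exact: card_le_trans AB.
Qed.

Lemma small_sum (kappa X Y : Type) : small kappa [set: nat] ->
  small kappa [set: X] -> small kappa [set: Y] -> small kappa [set: (X + Y)%type].
Proof.
(* The largest of X, Y and nat is an infinite small type that bounds both. *)
move=> smN smX smY.
have [Z [smZ NZ XZ YZ]] : exists Z : Type, [/\ small kappa [set: Z],
    ([set: nat] #<= [set: Z])%card, ([set: X] #<= [set: Z])%card
    & ([set: Y] #<= [set: Z])%card].
  have [Z [smZ XZ YZ]] : exists Z : Type, [/\ small kappa [set: Z],
      ([set: X] #<= [set: Z])%card & ([set: Y] #<= [set: Z])%card].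
    by have [XY|YX] := card_le_total X Y; [exists Y|exists X].
  have [ZN|NZ] := card_le_total Z nat; last by exists Z.
  by exists nat; split=> //; [exact: card_le_trans ZN|exact: card_le_trans ZN].
apply: small_le (small_le (infinite_double NZ) smZ).
have [/card_leTP[f fI] /card_leTP[g gI]] := (XZ, YZ).
apply/card_leTP; exists (fun k => match k with inl x => (f x, true)
  | inr y => (g y, false) end).
by move=> [x|y] [x'|y'] //= [] => [/fI|/gI] ->.
Qed.

(** * Finite support and finite quantification *)

Section Definability.
Variable L : language.

Lemma term_support V (t : term L V) : exists J : set V, finite_set J /\
  forall X (s : str_on L X) (u v : V -> X),
    (forall j, J j -> u j = v j) -> eval s u t = eval s v t.
Proof.
elim: t => [x|f ts IH].
  exists [set x]; split; first exact: finite_set1.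
  by move=> X s u v uv /=; exact: uv.
have [J JP] := choice IH; exists (\bigcup_i J i); split.
  by apply: bigcup_finite => // i _; exact: (JP i).1.
move=> X s u v uv /=; congr fun_interp; apply/funext => i.
by apply: (JP i).2 => j Jj; apply: uv; exists i.
Qed.

Lemma formula_support V (phi : formula L V) : exists J : set V, finite_set J /\
  forall X (s : str_on L X) (u v : V -> X),
    (forall j, J j -> u j = v j) -> sat s u phi <-> sat s v phi.
Proof.
elim: phi => {V} [V|V t1 t2|V r ts|V phi [J [fJ JP]] psi [K [fK KP]]|V phi [J [fJ JP]]].
- by exists set0; split.
- have [J [fJ JP]] := term_support t1; have [K [fK KP]] := term_support t2.
  exists (J `|` K); split; first by rewrite finite_setU.
  move=> X s u v uv /=.
  have e1 := JP X s u v (fun j Jj => uv j (or_introl Jj)).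
  have e2 := KP X s u v (fun j Kj => uv j (or_intror Kj)).
  by rewrite e1 e2.
- have [J JP] := choice (fun i => term_support (ts i)).
  exists (\bigcup_i J i); split.
    by apply: bigcup_finite => // i _; exact: (JP i).1.
  move=> X s u v uv /=.
  rewrite (_ : (fun i => _) = (fun i => eval s v (ts i)))//; apply/funext => i.
  by apply: (JP i).2 => j Jj; apply: uv; exists i.
- exists (J `|` K); split; first by rewrite finite_setU.
  move=> X s u v uv /=.
  have e1 := JP X s u v (fun j Jj => uv j (or_introl Jj)).
  have e2 := KP X s u v (fun j Kj => uv j (or_intror Kj)).
  by rewrite e1 e2.
- exists (Some @^-1` J); split.
    by apply: finite_preimage => // x y _ _ [].
  move=> X s u v uv /=.
  suff E x : sat s (ocons x u) phi <-> sat s (ocons x v) phi.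
    by split=> h x; [apply/E|apply/E].
  by apply: JP => -[j|//] Jj; exact: uv.
Qed.

Lemma conj_formula V (q : set (formula L V)) : finite_set q ->
  exists phi, forall X (s : str_on L X) (u : V -> X),
    sat s u phi <-> forall chi, q chi -> sat s u chi.
Proof.
move=> fq; have [l ->] : exists l : seq {classic formula L V}, q = [set` l].
  exact/finite_seqP.
elim: l => [|chi l [phi IH]]; first by exists (ftrue L V) => X s u; split=> // _ chi.
exists (fand chi phi) => X s u /=; split=> [h psi|h].
  rewrite inE => /predU1P[->|].
    by apply: contrapT => nchi; apply: h => /nchi.
  have /IH : sat s u phi by apply: contrapT => nphi; apply: h.
  by apply.
apply; first by apply: h; rewrite inE eqxx.
by apply/IH => psi lpsi; apply: h; rewrite inE lpsi orbT.
Qed.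

(** Formulas allow infinitely many variables but only quantify one at a time,
    which is why J has to be finite. *)
Lemma exists_formula V (J : set V) (phi : formula L V) : finite_set J ->
  exists psi, forall X (s : str_on L X) (u : V -> X),
    sat s u psi <-> exists v, (forall j, ~ J j -> v j = u j) /\ sat s v phi.
Proof.
move=> fJ; have [l ->] : exists l : seq {classic V}, J = [set` l].
  exact/finite_seqP.
elim: l => [|x l [psi IH]].
  exists phi => X s u; split=> [h|[v [vu]]]; first by exists u.
  by rewrite (_ : v = u)//; apply/funext => j; exact: vu.
pose bind_x (y : {classic V}) : option V := if y == x then None else Some y.
exists (fnot (All (fnot (rename bind_x psi)))) => X s u /=.
have bindE y : ocons y u \o bind_x = fun j : {classic V} => if j == x then y else u j.
  by apply/funext => j; rewrite /= /bind_x; case: eqP.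
split=> [h|[v [vu sv]] h].
  apply: contrapT => nex; apply: h => y; rewrite sat_rename IH bindE.
  move=> [v [vu sv]]; apply: nex; exists v; split=> // j /negP.
  by rewrite inE negb_or => /andP[/negPf jx /negP/vu ->]; rewrite jx.
apply: (h (v x)); rewrite sat_rename IH bindE; exists v; split=> // j nlj.
by case: eqP => [->//|/eqP jx]; apply: vu; rewrite /= inE (negPf jx).
Qed.

End Definability.

(** * Realizing types in many variables *)

Section Saturation.
Variables (L : language) (M : structure L) (kappa : Type).
Hypotheses (smN : small kappa [set: nat]) (satM : saturated M kappa).
Variables (I : Type) (A : set M).
Hypotheses (smI : small kappa [set: I]) (smA : small kappa A).
Variable p : set (formula L (I + A)).

(** A partial assignment S of values to the variables in I is a set of pairs
    rather than a partial function, because this makes consistency with the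
    type p a property of finite character, to which Zorn's lemma applies. *)
Definition consistent_assignment (S : set (I * M)) :=
  forall q J, q `<=` p -> finite_set q -> finite_set J ->
  exists v, realizes q v /\ forall j m, J j -> S (j, m) -> v j = m.

Lemma consistent_functional S j m m' :
  consistent_assignment S -> S (j, m) -> S (j, m') -> m = m'.
Proof.
move=> /(_ set0 [set j]) []// v [_ vS] Sm Sm'.
by rewrite -(vS _ _ erefl Sm) (vS _ _ erefl Sm').
Qed.

(** Saturation for one variable gives the value of the variable i: over the
    parameters of p and the values already assigned, which form a small set,
    the formulas that follow from finitely many members of p and finitely many
    values of S are finitely satisfiable, and a realization m will do. Indeed,
    the existence of a solution of a finite part of p with i sent to m is one of
    these formulas, obtained by quantifying the finitely many other variables
    that occur and have no value yet. *)
Lemma consistent_extend S i : consistent_assignment S ->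
  (forall m, ~ S (i, m)) -> exists m, consistent_assignment (S `|` [set (i, m)]).
Proof.
move=> cS nSi; have [m0] := str_inhabited (str M).
have /choice[s sE] : forall j, exists x, forall m, S (j, m) -> x = m.
  move=> j.
  have [[x Sx]|nS] := pselect (exists x, S (j, x)).
    by exists x => m; exact: consistent_functional.
  by exists m0 => m Sm; case: nS; exists m.
pose dom j := exists m, S (j, m).
pose A' : set M := A `|` range s.
have smA' : small kappa A'.
  pose h (k : A + I) := match k with inl a => val a | inr j => s j end.
  apply: (@small_le _ _ _ _ (range h)).
    apply: subset_card_le => m [Am|[j _ <-]]; last by exists (inr j).
    by exists (inl (SigSub (mem_set Am))).
  apply: small_image; apply: small_sum => //.
  by apply: small_le smA; rewrite (card_le_eql (card_setT A)).
pose parA (a : A) : A' := SigSub (mem_set (or_introl (set_mem (valP a)) : A' (val a))).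
pose parS (j : I) : A' := SigSub (mem_set (or_intror (imageT s j) : A' (s j))).
(* Variables with an assigned value become parameters; the variables other than
   i without a value are quantified before h is applied. *)
pose h (k : I + A) : unit + A' := match k with
  | inl j => if pselect (dom j) then inr (parS j) else inl tt
  | inr a => inr (parA a) end.
pose type1 : set (formula L (unit + A')) := [set psi | exists q J,
  [/\ q `<=` p, finite_set q, finite_set J & forall v, realizes q v ->
    (forall j m, J j -> S (j, m) -> v j = m) ->
    sat (str M) (joint (fun=> v i) val) psi]].
have [r rP rfin|x xP] := satM smA' (p := type1).
  have /choice[f fP] : forall psi, exists f : set (formula L (I + A)) * set I,
      r psi -> [/\ f.1 `<=` p, finite_set f.1, finite_set f.2
      & forall v, realizes f.1 v ->
        (forall j m, f.2 j -> S (j, m) -> v j = m) ->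
        sat (str M) (joint (fun=> v i) val) psi].
    move=> psi; have [/rP[q [J qJ]]|nr] := pselect (r psi); first by exists (q, J).
    by exists (set0, set0).
  have [] := cS (\bigcup_(psi in r) (f psi).1) (\bigcup_(psi in r) (f psi).2).
  - by move=> chi [psi /fP[fp _ _ _] /fp].
  - by apply: bigcup_finite => // psi /fP[].
  - by apply: bigcup_finite => // psi /fP[].
  move=> v [vq vJ]; exists (fun=> v i) => psi rpsi; have [_ _ _] := fP _ rpsi.
  apply=> [chi fchi|j m fj]; first by apply: vq; exists psi.
  by apply: vJ; exists psi.
exists (x tt) => q J qp qfin Jfin.
have [phi phiE] := conj_formula qfin.
have [K [Kfin KP]] := formula_support phi.
pose bound (k : I + A) := if k is inl j then ~ dom j /\ j <> i else False.
have [|psi psiE] := exists_formula phi (J := K `&` bound).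
  exact: finite_setIl.
have /xP : type1 (rename h psi).
  exists q, [set j | K (inl j)]; split=> // [|v vq vK].
    by apply: finite_preimage => // j j' _ _ [].
  apply/sat_rename/psiE.
  exists (fun k => if pselect (K k) then joint v val k
                   else joint (fun=> v i) val (h k)).
  split=> [k nb|].
    case: pselect => //= Kk; have {}nb : ~ bound k by move=> b; apply: nb.
    case: k Kk nb => [j|a] //= Kj nb.
    case: pselect => [[m Sjm]|ndom] /=; first by rewrite (vK _ _ Kj Sjm) (sE _ _ Sjm).
    by congr v; apply: contrapT => ji; apply: nb.
  apply/(KP _ _ _ (joint v val)) => [k Kk|]; first by case: pselect.
  by apply/phiE.
move=> /sat_rename/psiE[v [vE /phiE vq]]; exists (v \o inl); split.
  move=> chi qchi; rewrite (_ : joint _ _ = v); first exact: vq.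
  apply/funext => -[j//|a] /=; rewrite vE; last by case.
  by [].
move=> j m Jj [Sjm|[-> ->]] /=.
  rewrite vE; last by case=> _ [nd _]; apply: nd; exists m.
  rewrite /=; case: pselect => [dj|[]] /=; last by exists m.
  exact: sE.
rewrite vE; last by case=> _ [].
by rewrite /=; case: pselect => [[y /nSi]|] /=.
Qed.

(** The hypothesis [satM] only speaks of one variable; a maximal consistent
    assignment realizes a type in a small set of variables. *)
Lemma saturated_tuple : finitely_satisfiable p -> exists u, realizes p u.
Proof.
move=> fp; have [F FP Ftot|S [cS Smax]] := @Zorn_bigcup _ consistent_assignment.
  have [[S0 FS0]|F0] := pselect (F !=set0); last first.
    move=> q J qp qfin _; have [v vq] := fp q qp qfin.
    by exists v; split=> // j m _ [S FS]; case: F0; exists S.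
  move=> q J qp qfin Jfin.
  have [S1 [FS1 S1P]] : exists S, F S /\
      forall j m, J j -> (\bigcup_(S in F) S) (j, m) -> S (j, m).
    have [l ->] : exists l : seq {classic I}, J = [set` l] by exact/finite_seqP.
    elim: l => [|j l [S [FS SP]]]; first by exists S0; split.
    have [[m Fm]|Fj] := pselect (exists m, (\bigcup_(S in F) S) (j, m)).
      have [S' FS' S'm] := Fm.
      have [S2 [FS2 SS2 S2m]] : exists S2, [/\ F S2, S `<=` S2 & S2 (j, m)].
        have [SS'|S'S] := Ftot _ _ FS FS'; first by exists S'.
        by exists S; split=> //; exact: S'S.
      exists S2; split=> // j' m'; rewrite /= inE => /predU1P[->|lj'] Fm'.
        have [S3 [FS3 S3m S3m']] := chain_pair Ftot Fm Fm'.
        by rewrite -(consistent_functional (FP _ FS3) S3m S3m').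
      exact/SS2/SP.
    exists S; split=> // j' m'; rewrite /= inE => /predU1P[->|lj'] Fm'.
      by case: Fj; exists m'.
    exact: SP.
  have [v [vq vS]] := FP _ FS1 q J qp qfin Jfin; exists v; split=> // j m Jj Fjm.
  by apply: vS => //; exact: S1P.
have dom i : exists m, S (i, m).
  apply: contrapT => /forallNP ni; have [m /Smax] := consistent_extend cS ni.
  apply; split=> [y|/(_ (i, m) (or_intror erefl)) /ni//]; by left.
have [u uP] := choice dom; exists u => phi pphi.
have [J [Jfin JP]] := formula_support phi.
have [||| v [vphi vJ]] := cS [set phi] [set j | J (inl j)].
- by move=> _ ->.
- exact: finite_set1.
- by apply: finite_preimage => // j j' _ _ [].
apply/(JP _ _ _ (joint v val)); last exact: vphi.
by move=> [j|a] //= Jj; rewrite (vJ _ _ Jj (uP j)).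
Qed.

End Saturation.

(** * Ultrafilters *)

Lemma filter_finite_forall (T X : Type) (U : set_system T) (q : set X)
    (P : X -> set T) : Filter U -> finite_set q ->
  (forall x, q x -> U (P x)) -> U [set n | forall x, q x -> P x n].
Proof.
move=> FU fq; have [l ->] : exists l : seq {classic X}, q = [set` l].
  exact/finite_seqP.
elim: l => [_|x l IH lP]; first by apply: filterS filterT => n _ x.
have Ul : U [set n | forall x : X, [set` l] x -> P x n].
  by apply: IH => y ly; apply: lP; rewrite /= inE ly orbT.
have Ux : U (P x) by apply: lP; rewrite /= inE eqxx.
apply: filterS (filterI Ux Ul) => n [Pxn Pln] y.
by rewrite /= inE => /predU1P[->//|/Pln].
Qed.

Lemma ultra_not (T : Type) (U : set_system T) (A : set T) : UltraFilter U ->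
  U (~` A) <-> ~ U A.
Proof.
move=> UU; split=> [UnA UA|nUA]; last by have [] := in_ultra_setVsetC A UU.
by have [n []] := filter_ex (filterI UnA UA).
Qed.

Lemma ultra_pigeonhole (T X : Type) (U : set_system T) (q : set X) (f : T -> X) :
  UltraFilter U -> finite_set q -> (forall n, q (f n)) ->
  exists2 x, q x & U [set n | f n = x].
Proof.
move=> UU fq qf; apply: contrapT => /forall2NP nU.
have /filter_ex[n /(_ (f n) (qf n))] : U [set n | forall x, q x -> f n <> x].
  by apply: filter_finite_forall => // x qx; apply/ultra_not; case: (nU x).
exact.
Qed.

Lemma free_ultrafilter : exists U : set_system nat,
  UltraFilter U /\ forall m, U [set n | (m < n)%N].
Proof.
have [U [UU ooU]] := ultraFilterLemma eventually_filter.
by exists U; split=> // m; apply: ooU; exists m.+1.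
Qed.

(** * Conjugates of a closed subgroup of finite relative index *)

Section ConjugatesOfClosedSubgroup.
Local Open Scope group_scope.
Variables (Gam : groupType) (U : set_system nat) (lim : (nat -> Gam) -> Gam).
Hypotheses (UU : UltraFilter U) (Uoo : forall m, U [set n | (m < n)%N]).
Hypothesis limM : forall x y, lim (fun n => x n * y n) = lim x * lim y.
Hypothesis lim_cst : forall x, lim (fun=> x) = x.

Variables (B C : set Gam).
Hypothesis subB : is_subgroup B.
Hypothesis limB : forall x, U [set n | B (x n)] -> B (lim x).
Hypothesis indexB :
  exists2 R, finite_set R & forall x, C x -> exists2 t, R t & B (t^-1 * x).

Lemma limV x : lim (fun n => (x n)^-1) = (lim x)^-1.
Proof.
apply: (mulIg (lim x)); rewrite -limM mulVg -[RHS]lim_cst.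
by congr lim; apply/funext => n; rewrite mulVg.
Qed.

(** In a compact Hausdorff group the conjugates of a closed subgroup B that has
    finite index in C cut out the core of B inside the core of C in finitely
    many steps. Otherwise there are x_n in the core of C and g_n such that x_n
    lies in the conjugate of B by g_j for all j < n but not in the one by g_n.
    Let x and g be limits of x_n and g_n. Then x lies in the conjugate of B by
    each g_j, hence in the one by g. On the other hand, for almost all n the
    conjugate of x_n by g_n lies in one fixed nontrivial coset t B, so in the
    limit B meets t B, which is absurd. What carries the argument is that limits
    along a free ultrafilter on nat form a homomorphism that fixes constant
    sequences and preserves B; compactness and separation are contained in the
    existence of this homomorphism. *)
Lemma finitely_many_conjugates : exists s : seq Gam, forall x,
  (forall g, C (g^-1 * x * g)) -> (forall g, g \in s -> B (g^-1 * x * g)) ->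
  forall g, B (g^-1 * x * g).
Proof.
have [B1 BM BV] := subB; have [R Rfin RP] := indexB.
apply: contrapT => /forallNP nos.
have /choice[F FP] : forall s : seq Gam, exists xg : Gam * Gam,
    [/\ forall g, C (g^-1 * xg.1 * g),
        forall g, g \in s -> B (g^-1 * xg.1 * g)
      & ~ B (xg.2^-1 * xg.1 * xg.2)].
  move=> s; have /existsNP[x /not_implyP[Cx /not_implyP[Bx]]] := nos s.
  by move=> /existsNP[g nBg]; exists (x, g).
pose s := fix s n := if n is n'.+1 then (F (s n')).2 :: s n' else [::].
pose x n := (F (s n)).1; pose g n := (F (s n)).2.
have gs j n : (j < n)%N -> g j \in s n.
  elim: n => // n IH; rewrite ltnS leq_eqVlt inE => /predU1P[->|/IH ->].
    by rewrite eqxx.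
  by rewrite orbT.
have /choice[r rP] : forall n, exists t, R t /\ B (t^-1 * ((g n)^-1 * x n * g n)).
  by move=> n; have [Cx _ _] := FP (s n); have [t] := RP _ (Cx (g n)); exists t.
have [t Rt Ut] := ultra_pigeonhole UU Rfin (fun n => (rP n).1).
have Utg : U [set n | B (t^-1 * ((g n)^-1 * x n * g n))].
  by apply: filterS Ut => n <-; exact: (rP n).2.
have limBx : B ((lim g)^-1 * lim x * lim g).
  rewrite -limV -(lim_cst (lim x)) -!limM; apply: limB.
  (* For fixed j almost all n are larger than j. *)
  apply: filterE => j /=; rewrite -(lim_cst (g j)) -limV -!limM; apply: limB.
  apply: filterS (Uoo j) => n jn; have [_ Bx _] := FP (s n).
  by apply: Bx; exact: gs.
have Bt : B t.
  have : B (t^-1 * ((lim g)^-1 * lim x * lim g)).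
    by rewrite -limV -(lim_cst t) -limV -!limM; apply: limB.
  by move=> /BV /(BM _ _ limBx); rewrite invgM invgK mulgA mulgV mul1g.
have [n BBn] := filter_ex Utg; have [_ _] := FP (s n); apply.
by have := BM _ _ Bt BBn; rewrite mulVKg.
Qed.

End ConjugatesOfClosedSubgroup.

(** * Ultralimits of tuples and of automorphisms *)

Section Ultralimits.
Variables (L : language) (M : structure L) (U : set_system nat).
Hypothesis UU : UltraFilter U.

(** The type of u over the empty set is the ultralimit of the types of the us n,
    that is, their limit in the Stone space. Parameters are handled by adding
    them to the tuple as constant coordinates, with [joint]. *)
Definition ultralimit I (us : nat -> I -> M) (u : I -> M) := forall phi : formula L I,
  sat (str M) u phi <-> U [set n | sat (str M) (us n) phi].

Lemma ultralimit_comp I I' (h : I' -> I) us u :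
  ultralimit us u -> ultralimit (fun n => us n \o h) (u \o h).
Proof.
move=> usu phi; have := usu (rename h phi); rewrite sat_rename => ->.
by split; apply: filterS => n; rewrite /= sat_rename.
Qed.

Lemma ultralimit_cst I (u : I -> M) : ultralimit (fun=> u) u.
Proof.
move=> phi; split=> [h|/filter_ex[]//]; exact: filterE.
Qed.

Lemma ultralimit_germ I us us' (u : I -> M) :
  U [set n | us n = us' n] -> ultralimit us u -> ultralimit us' u.
Proof.
move=> e usu phi; rewrite usu.
by split=> h; apply: filterS (filterI e h) => n [/= <-].
Qed.

(** Types over the empty set do not see automorphisms, even varying ones. *)
Lemma ultralimit_aut I (g : nat -> aut M) us (u : I -> M) :
  ultralimit (fun n => g n \o us n) u <-> ultralimit us u.
Proof.
by split=> usu phi; rewrite usu; split; apply: filterS => n /=; rewrite -sat_aut.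
Qed.

Lemma ultralimit_unique I us (u u' : I -> M) : ultralimit us u -> ultralimit us u' ->
  forall phi, sat (str M) u phi <-> sat (str M) u' phi.
Proof. by move=> usu usu' phi; rewrite usu usu'. Qed.

Variable kappa : Type.
Hypotheses (smN : small kappa [set: nat]) (satM : saturated M kappa).
Hypothesis homM : strongly_homogeneous M kappa.

Lemma homogeneous_tuple I (u v : I -> M) : small kappa [set: I] ->
  (forall phi, sat (str M) u phi <-> sat (str M) v phi) ->
  exists f : aut M, f \o u = v.
Proof.
move=> smI uv.
have /choice[k kE] : forall x : range u, exists i, u i = val x.
  by case=> x /= /set_mem[i _ <-]; exists i.
have [phi|f [fA fE]] := homM (small_image u smI) (g := v \o k).
  rewrite -sat_rename -uv sat_rename.
  by rewrite (_ : u \o k = val)//; apply/funext => x; exact: kE.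
exists (Aut (asboolT fA)); apply/funext => i /=.
have := fE (SigSub (mem_set (imageT u i))) => /= ->.
exact: ((uv (Eqn (Var L _) (Var L i))).1 (kE (SigSub (mem_set (imageT u i))))).
Qed.

Lemma ultralimit_exists I J (us : nat -> I -> M) (v : J -> M) :
  small kappa [set: I] -> small kappa [set: J] ->
  exists u, ultralimit (fun n => joint (us n) v) (joint u v).
Proof.
move=> smI smJ.
have smv : small kappa (range v) by exact: small_image.
pose h (k : I + J) : I + range v := match k with inl i => inl i
  | inr j => inr (SigSub (mem_set (imageT v j))) end.
have hE (u : I -> M) : joint u val \o h = joint u v by apply/funext => -[].
pose p := [set rename h phi | phi in
  [set phi | U [set n | sat (str M) (joint (us n) v) phi]]].
have [q qp qfin|u up] := saturated_tuple smN satM smI smv (p := p).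
  suff /filter_ex[n nq] : U [set n | realizes q (us n)] by exists (us n).
  apply: filter_finite_forall => // _ /qp[phi Uphi <-].
  by apply: filterS Uphi => n; rewrite /= sat_rename hE.
exists u; have up' phi : U [set n | sat (str M) (joint (us n) v) phi] ->
    sat (str M) (joint u v) phi.
  by move=> Uphi; rewrite -hE -sat_rename; apply: up; exists phi.
move=> phi; split=> [uphi|/up'//]; apply: contrapT => nU.
have nphi := (ultra_not _ UU).2 nU.
by have /(_ uphi) := up' (fnot phi) nphi.
Qed.

Lemma hact_hcls D (f : aut M) (a : tidx D -> M) : hact f (hcls D a) = hcls D (f \o a).
Proof.
apply: himag_ext; apply/seteqP; split=> [_ [u au <-]|u fau] /=.
  exact/tdrel_aut.
exists ((f^-1%g : aut M) \o u); last by apply/funext => i /=; exact: autVK.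
apply/(tdrel_aut f); rewrite (_ : f \o (_ \o u) = u)//.
by apply/funext => i /=; exact: autVK.
Qed.

Lemma hcls_eqP D (a a' : tidx D -> M) : hcls D a = hcls D a' <-> tdrel D a a'.
Proof.
split=> [/(congr1 (@hclass _ _ _)) /= e|aa'].
  by rewrite e; exact: td_refl.
apply: himag_ext; apply/seteqP; split=> u /= h; last exact: td_trans h.
by apply: td_trans h; exact: td_sym.
Qed.

Lemma ultralimit_tdrel D us us' (u u' : tidx D -> M) :
  ultralimit (fun n => joint (us n) (us' n)) (joint u u') ->
  U [set n | tdrel D (us n) (us' n)] -> tdrel D u u'.
Proof.
have [p pP] := td_def D; move=> lu Ur; apply/pP => phi pphi; apply/lu.
by apply: filterS Ur => n /= /pP; apply.
Qed.

Variables (W : Type) (w : W -> M).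
Hypothesis smW : small kappa [set: W].

(** The automorphism g is a limit of the gs n as far as the type of the image of
    the fixed small tuple w over w can tell. Such a limit is far from unique,
    but it is unique in the Lascar group when w contains a model over which e is
    definable. *)
Definition aut_limit (gs : nat -> aut M) (g : aut M) :=
  ultralimit (fun n => joint (gs n \o w) w) (joint (g \o w) w).

Lemma aut_limit_cst g : aut_limit (fun=> g) g.
Proof. exact: ultralimit_cst. Qed.

Lemma aut_limit_germ gs gs' g :
  U [set n | gs n = gs' n] -> aut_limit gs g -> aut_limit gs' g.
Proof. by move=> e; apply: ultralimit_germ; apply: filterS e => n /= ->. Qed.

Lemma aut_limit_exists gs : exists g, aut_limit gs g.
Proof.
have [u uP] := ultralimit_exists (fun n => gs n \o w) w smW smW.
have [phi|g gw] := homogeneous_tuple smW (u := w) (v := u).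
  have wu : ultralimit (fun=> w) u.
    by apply/(ultralimit_aut gs); exact: (ultralimit_comp inl uP).
  exact: ultralimit_unique (ultralimit_cst w) wu phi.
by exists g; rewrite /aut_limit gw.
Qed.

Lemma aut_limit_unique gs g g' : aut_limit gs g -> aut_limit gs g' ->
  exists k : aut M, k \o w = w /\ (k \o g) \o w = g' \o w.
Proof.
move=> lg lg'; have smWW := small_sum smN smW smW.
have [k kE] := homogeneous_tuple smWW (ultralimit_unique lg lg').
exists k; split.
  exact: (congr1 (fun u => u \o inr) kE).
exact: (congr1 (fun u => u \o inl) kE).
Qed.

(** Multiplication is jointly continuous in the following sense: take a joint
    limit (x, y) of the images of w under gs n and gs n * hs n. Applying the
    inverse of gs n shows that (x, y) has the type of (w, h w), so that a single
    automorphism g takes (w, h w) to (x, y). *)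
Lemma aut_limitM gs hs h : aut_limit hs h ->
  exists g, aut_limit gs g /\ aut_limit (fun n => gs n * hs n)%g (g * h)%g.
Proof.
move=> lh; have smWW := small_sum smN smW smW.
have [u uP] := ultralimit_exists (fun n => gs n \o joint (hs n \o w) w) w smWW smW.
have [phi|g gE] := homogeneous_tuple smWW (u := joint (h \o w) w) (v := u).
  apply: (ultralimit_unique lh); apply/(ultralimit_aut gs).
  exact: (ultralimit_comp inl uP).
exists g; split.
  pose i (k : W + W) : (W + W) + W := match k with inl x => inl (inr x)
    | inr x => inr x end.
  have := ultralimit_comp i uP; rewrite /aut_limit -gE.
  rewrite (_ : joint _ w \o i = joint (g \o w) w); last by apply/funext => -[].
  congr (ultralimit _ _); apply/funext => n.
  by apply/funext => -[].
pose i (k : W + W) : (W + W) + W := match k with inl x => inl (inl x)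
  | inr x => inr x end.
have := ultralimit_comp i uP; rewrite /aut_limit -gE.
rewrite (_ : joint _ w \o i = joint ((g * h)%g \o w) w); last by apply/funext => -[].
by congr (ultralimit _ _); apply/funext => n; apply/funext => -[].
Qed.

(** The equality of two classes of a type-definable equivalence relation is a
    closed condition on representatives. *)
Lemma aut_limit_stab D (i : tidx D -> W) gs g : aut_limit gs g ->
  U [set n | hact (gs n) (hcls D (w \o i)) = hcls D (w \o i)] ->
  hact g (hcls D (w \o i)) = hcls D (w \o i).
Proof.
move=> lg Ug; rewrite hact_hcls; apply/hcls_eqP.
pose ii (k : tidx D + tidx D) := match k with inl j => inl (i j)
  | inr j => inr (i j) end.
have jE (f : aut M) : joint (f \o w) w \o ii = joint ((f \o w) \o i) (w \o i).
  by apply/funext => -[].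
apply: (@ultralimit_tdrel D (fun n => (gs n \o w) \o i) (fun=> w \o i)).
  have := ultralimit_comp ii lg; rewrite jE.
  by congr (ultralimit _ _); apply/funext => n; rewrite jE.
by apply: filterS Ug => n; rewrite /= hact_hcls => /hcls_eqP.
Qed.

End Ultralimits.

(** * The topology of the Lascar group *)

Local Open Scope group_scope.

Lemma qprojM (G : groupType) (N : normal_subgroup G) x y :
  qproj N (x * y) = qproj N x * qproj N y.
Proof. exact: gmulfM. Qed.

Lemma qprojV (G : groupType) (N : normal_subgroup G) x :
  qproj N x^-1 = (qproj N x)^-1.
Proof. exact: gmulfV. Qed.

Section Compactness.
Variables (L : language) (M : structure L) (kappa : Type).
Hypotheses (smN : small kappa [set: nat]) (homM : strongly_homogeneous M kappa).
Variables (E : td_equiv M) (e : himag E).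

Local Notation proj := (qproj (autf kappa e)).

Lemma qproj_fix_model (k : autE e) (N : small_model kappa e) :
  (forall x, smodel N x -> k x = x) -> proj k = 1.
Proof.
move=> kN; apply/esym/qprojP; rewrite invg1 mul1g.
by apply: sub_gen_smallest; exists N.
Qed.

(** The product of the inverse of g' with k and g fixes the model N. *)
Lemma qproj_same_type (g g' k : autE e) (N : small_model kappa e) :
  proj k = 1 -> (forall x, smodel N x -> k (g x) = g' x) -> proj g = proj g'.
Proof.
move=> k1 kg; have : proj (g'^-1 * (k * g)) = 1.
  apply: (@qproj_fix_model _ N) => x Nx.
  rewrite -[LHS]/((g'^-1%g : autE e) (k (g x))) kg//.
  by rewrite -[LHS]/((g'^-1 * g')%g x) mulVg.
rewrite !qprojM k1 mul1g qprojV => /(congr1 (fun x => proj g' * x)).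
by rewrite mulVKg mulg1.
Qed.

Lemma autE_of (k : aut M) : hact k e = e -> exists k' : autE e, autE_aut k' = k.
Proof. by move=> ke; exists (AutE (asboolT ke)). Qed.

Lemma small_smodel (N : small_model kappa e) : small kappa [set: smodel N].
Proof.
apply: (small_le _ (smodel_small N)).
by rewrite (card_le_eql (card_setT _)).
Qed.

Variables N1 N2 : small_model kappa e.

(** The map [nu] picks some automorphism g with the same type of g(N1) over N2 as
    f(N1). By homogeneity an automorphism k that fixes N2 takes g(N1) to f(N1),
    and k represents the identity of the Lascar group. *)
Lemma nu_tp_model (f : autE e) : nu (tp_model N1 N2 f : subspace _) = proj f.
Proof.
rewrite /nu; case: xgetP => [g _ /= gf|/(_ f)/=/(_ erefl)//].
have {}gf : forall phi : formula L (smodel N1 + smodel N2),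
    sat (str M) (joint (g \o val) val) phi <->
    sat (str M) (joint (f \o val) val) phi.
  by move=> phi; have /(congr1 (fun p => stype p phi)) /= := gf => ->.
have smNN := small_sum smN (small_smodel N1) (small_smodel N2).
have [k kE] := homogeneous_tuple homM smNN gf.
have kN2 x : smodel N2 x -> k x = x.
  by move=> N2x; have /(congr1 (@^~ (inr (SigSub (mem_set N2x))))) := kE.
have [k' k'E] := autE_of (smodel_dcl kN2).
apply: (@qproj_same_type _ _ k' N1) => [|x N1x].
  by apply: (@qproj_fix_model _ N2) => x /kN2; rewrite k'E.
by rewrite k'E; have /(congr1 (@^~ (inl (SigSub (mem_set N1x))))) := kE.
Qed.

(** If {1} is closed, each nontrivial class is separated from 1 by a basic open
    set of the Stone space. This is the only way in which G-compactness enters. *)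
Lemma G_compact_formula (g : autE e) :
  closed ([set (1 : gal kappa e)] : set (gal_top N1 N2)) -> proj g <> 1 ->
  exists phi : formula L (smodel N1 + smodel N2),
    sat (str M) (joint (g \o val) val) phi /\
    forall f : autE e, proj f = 1 -> ~ sat (str M) (joint (f \o val) val) phi.
Proof.
move=> cl1 g1.
have : open (~` [set (1 : gal kappa e)] : set (gal_top N1 N2)) by rewrite openC.
rewrite -[open _]/(open (@nu _ _ _ _ e N1 N2 @^-1` ~` [set (1 : gal kappa e)])).
move=> /open_subspaceP[V oV VE]; move: oV => [D _ DV].
have tpS f : stone_model (N2:=N2) (tp_model N1 N2 f) by exists f.
have : (V `&` stone_model (N2:=N2)) (tp_model N1 N2 g).
  by rewrite VE; split=> //; rewrite /= nu_tp_model.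
rewrite -DV => -[[phi Dphi gphi] _]; exists phi; split=> // f f1 fphi.
have : (V `&` stone_model (N2:=N2)) (tp_model N1 N2 f).
  by split=> //; rewrite -DV; exists phi.
by rewrite VE => -[/=]; rewrite nu_tp_model.
Qed.

End Compactness.

(** * Limits in the Lascar group *)

Section LascarLimits.
Variables (L : language) (M : structure L) (kappa : Type).
Hypotheses (smN : small kappa [set: nat]) (satM : saturated M kappa).
Hypothesis homM : strongly_homogeneous M kappa.
Variables (E : td_equiv M) (e : himag E).
Variables (U : set_system nat).
Hypothesis UU : UltraFilter U.

Local Notation proj := (qproj (autf kappa e)).

(** The image in the Lascar group of the stabilizer of d; its cosets correspond
    to the Lascar classes of the realizations of tp(d/e), by [lascar_stab]. *)
Definition stab_class D (d : himag D) : set (gal kappa e) :=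
  [set proj s | s in [set s : autE e | hact s d = d]].

Lemma stab_class_subgroup D (d : himag D) : is_subgroup (stab_class d).
Proof.
split.
- by exists 1; [exact: autE_act1|exact: gmulf1].
- move=> _ _ [s sd <-] [t td <-]; exists (s * t); last exact: qprojM.
  by rewrite /= autE_actM td.
- move=> _ [s sd <-]; exists s^-1; last exact: qprojV.
  by rewrite /= -{1}sd autE_actK.
Qed.

Variables N1 N2 : small_model kappa e.
Hypothesis closed1 : closed ([set (1 : gal kappa e)] : set (gal_top N1 N2)).

Variables (W : Type) (w : W -> M).
Hypothesis smW : small kappa [set: W].
Variables (i1 : smodel N1 -> W) (i2 : smodel N2 -> W) (iE : tidx E -> W).
Hypotheses (w1 : w \o i1 = val) (w2 : w \o i2 = val) (wE : e = hcls E (w \o iE)).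

Local Notation lim_to gs g :=
  (aut_limit U w (fun n => autE_aut (gs n)) (autE_aut (g : autE e))).

Lemma aut_limit_autE (gs : nat -> autE e) (g : aut M) :
  aut_limit U w (fun n => autE_aut (gs n)) g ->
  exists2 g' : autE e, lim_to gs g' & autE_aut g' = g.
Proof.
move=> lg; have [|g' g'g] := @autE_of _ _ _ e g; last by exists g'; rewrite ?g'g.
rewrite wE; apply: (aut_limit_stab UU lg).
by apply: filterE => n; rewrite /= -wE autEP.
Qed.

Lemma autE_limit_exists (gs : nat -> autE e) : exists g, lim_to gs g.
Proof.
have [g /aut_limit_autE[g' lg' _]] :=
  aut_limit_exists UU smN satM homM w smW (fun n => autE_aut (gs n)).
by exists g'.
Qed.

(** Two limits give images of w with the same type over w. So some k fixing w
    takes one image to the other, and k fixes a model over which e is definable. *)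
Lemma autE_limit_unique (gs : nat -> autE e) g g' :
  lim_to gs g -> lim_to gs g' -> proj g = proj g'.
Proof.
move=> lg lg'; have [k [kw kg]] := aut_limit_unique smN homM smW lg lg'.
have [|k' k'k] := @autE_of _ _ _ e k.
  by rewrite wE hact_hcls -[k \o _]/((k \o w) \o iE) kw.
have val1 x (N1x : smodel N1 x) : x = w (i1 (SigSub (mem_set N1x))).
  by rewrite -[RHS]/((w \o i1) _) w1.
apply: (@qproj_same_type _ _ _ _ _ _ _ k' N1) => [|x N1x].
  apply: (@qproj_fix_model _ _ _ _ _ _ N1) => x N1x.
  by rewrite (val1 x N1x) k'k -[LHS]/((k \o w) _) kw.
by rewrite (val1 x N1x) k'k -[LHS]/(((k \o g) \o w) _) kg.
Qed.

(** Autf_e is closed under limits because the identity of the Lascar group is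
    closed, and the separating formula only involves coordinates of w. *)
Lemma autf_limit (gs : nat -> autE e) g :
  U [set n | proj (gs n) = 1] -> lim_to gs g -> proj g = 1.
Proof.
move=> U1 lg; apply: contrapT => /(G_compact_formula smN homM closed1).
move=> [phi [gphi phi1]].
pose i (k : smodel N1 + smodel N2) := match k with
  | inl x => inl (i1 x) | inr y => inr (i2 y) end.
have iE' (f : aut M) : joint (f \o w) w \o i = joint (f \o val) val.
  by rewrite -w1 -w2; apply/funext => -[].
have := ultralimit_comp UU i lg; rewrite iE' => /(_ phi)[/(_ gphi) Uphi _].
have [n [/= n1]] := filter_ex (filterI U1 Uphi).
by rewrite iE'; exact: phi1.
Qed.

Lemma autE_limitM (gs hs : nat -> autE e) g h k : lim_to gs g -> lim_to hs h ->
  lim_to (fun n => gs n * hs n) k -> proj k = proj g * proj h.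
Proof.
move=> lg lh lk.
have [g0 [lg0 lgh0]] := aut_limitM UU smN satM homM smW (fun n => autE_aut (gs n)) lh.
have [g' lg' g'g0] := aut_limit_autE lg0.
rewrite (autE_limit_unique lg lg') -qprojM; apply: (autE_limit_unique lk).
by rewrite -g'g0 in lgh0.
Qed.

Definition gal_lim (x : nat -> gal kappa e) : gal kappa e :=
  proj (sval (cid (autE_limit_exists (fun n => repr (x n))))).

(** The limit does not depend on the representatives, since these differ by
    elements of Autf_e, whose limits are again in Autf_e. *)
Lemma gal_limE (x : nat -> gal kappa e) gs g :
  U [set n | proj (gs n) = x n] -> lim_to gs g -> gal_lim x = proj g.
Proof.
rewrite /gal_lim; case: cid => h /= lh Ux lg.
have [k lk] := autE_limit_exists (fun n => (gs n)^-1 * repr (x n)).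
have k1 : proj k = 1.
  apply: autf_limit lk; apply: filterS Ux => n /= xn.
  by rewrite qprojM qprojV xn qproj_repr mulVg.
rewrite (autE_limitM lg lk (k := h)) ?k1 ?mulg1//.
apply: (aut_limit_germ UU _ lh); apply: filterE => n /=.
by rewrite mulVKg.
Qed.

Lemma gal_limM x y : gal_lim (fun n => x n * y n) = gal_lim x * gal_lim y.
Proof.
have [g lg] := autE_limit_exists (fun n => repr (x n)).
have [h lh] := autE_limit_exists (fun n => repr (y n)).
have [k lk] := autE_limit_exists (fun n => repr (x n) * repr (y n)).
have -> : gal_lim x = proj g.
  by apply: gal_limE lg; apply: filterE => n; exact: qproj_repr.
have -> : gal_lim y = proj h.
  by apply: gal_limE lh; apply: filterE => n; exact: qproj_repr.
rewrite -(autE_limitM lg lh lk); apply: gal_limE lk.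
by apply: filterE => n; rewrite /= qprojM !qproj_repr.
Qed.

Lemma gal_lim_cst x : gal_lim (fun=> x) = x.
Proof.
rewrite -[RHS]qproj_repr; apply: (gal_limE (gs := fun=> repr x)).
  by apply: filterE => n; exact: qproj_repr.
exact: (aut_limit_cst UU w (autE_aut (repr x))).
Qed.

(** Representatives that fix the hyperimaginary can be chosen almost everywhere,
    and fixing it is a closed condition. *)
Lemma gal_lim_stab D (iD : tidx D -> W) x :
  U [set n | stab_class (hcls D (w \o iD)) (x n)] ->
  stab_class (hcls D (w \o iD)) (gal_lim x).
Proof.
move=> Ux; have /choice[gs gsP] : forall n, exists g : autE e,
    stab_class (hcls D (w \o iD)) (x n) ->
    hact g (hcls D (w \o iD)) = hcls D (w \o iD) /\ proj g = x n.
  move=> n; have [[s sd sx]|?] := pselect (stab_class (hcls D (w \o iD)) (x n)).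
    by exists s.
  by exists 1.
have [g lg] := autE_limit_exists gs; exists g.
  by apply: (aut_limit_stab UU lg); apply: filterS Ux => n /gsP[].
by apply/esym/(gal_limE _ lg); apply: filterS Ux => n /gsP[].
Qed.

End LascarLimits.

(** * The kernel of the projection of relativized Lascar groups *)

Section Relativized.
Variables (L : language) (M : structure L) (kappa : Type).
Variables (E : td_equiv M) (e : himag E).

Local Notation proj := (qproj (autf kappa e)).

Lemma lascar_stab D (d : himag D) (f : autE e) :
  lascar_eq kappa e d (hact f d) <-> stab_class d (proj f).
Proof.
split=> [[n [Nn nd]]|[s sd sf]].
  exists (n^-1 * f); first by rewrite /= hactM -nd hactK.
  rewrite qprojM qprojV (_ : proj n = 1) ?invg1 ?mul1g//.
  by apply/esym/qprojP; rewrite invg1 mul1g.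
exists (f * s^-1); split.
  have : proj 1 = proj (f * s^-1) by rewrite qprojM qprojV sf mulgV; exact: gmulf1.
  by move=> /qprojP; rewrite invg1 mul1g.
by rewrite autE_actM -{1}sd autE_actK.
Qed.

Lemma proj_conj (f g : autE e) :
  (proj g)^-1 * proj f * proj g = proj (g^-1 * f * g).
Proof. by rewrite !qprojM qprojV. Qed.

(** Acting by g turns the condition on the realization g d into one on a conjugate
    of f; so Autf^1(tp(d/e)) comes from the core of the stabilizer class of d. *)
Lemma autf1_stab D (d : himag D) (f : autE e) :
  autf1_set kappa (restr d f) <->
  forall g : gal kappa e, stab_class d (g^-1 * proj f * g).
Proof.
split=> [f1 x|fS x].
  rewrite -(qproj_repr x); set g := repr x.
  rewrite proj_conj; apply/lascar_stab.
  have gd : hact g d \in realization e d by apply/mem_set; exists g.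
  pose y : realization e d := SigSub gd.
  have := lascar_eq_act g^-1 (f1 y).
  by rewrite restrE autE_actK -[hact f _]autE_actM -autE_actM mulgA.
have [g _ gx] := set_mem (valP x).
have := fS (proj g); rewrite proj_conj => /lascar_stab.
move=> /(lascar_eq_act g).
by rewrite -autE_actM !mulgA mulgV mul1g autE_actM gx.
Qed.

(** The stabilizer of b and e acts on the finite orbit of c, and the stabilizer of
    c in this action is that of bc. *)
Lemma stab_class_index F G (b : himag F) (c : himag G) : acl_over c b e ->
  exists2 R, finite_set R & forall x, @stab_class _ _ kappa _ e _ b x ->
    exists2 t, R t & stab_class (hpair b c) (t^-1 * x).
Proof.
move=> fc; pose orb := [set hact f c | f in [set f : autE e | hact f b = b]].
have forb : finite_set orb.
  apply: sub_finite_set fc => _ [f fb <-]; exists (autE_aut f) => //.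
  by split=> //; exact: autEP.
have /choice[r rP] : forall y, exists t : autE e, orb y -> hact t b = b /\ hact t c = y.
  by move=> y; have [[t tb ty]|?] := pselect (orb y); [exists t|exists 1].
exists [set proj (r y) | y in orb]; first exact: finite_image.
move=> _ [f fb <-]; have oy : orb (hact f c) by exists f.
exists (proj (r (hact f c))); first by exists (hact f c).
have [] := rP _ oy; set t := r _ => tb tc.
exists (t^-1 * f); last by rewrite qprojM qprojV.
by rewrite /= hact_pair !hactM fb -{1}tb -tc !hactK.
Qed.

End Relativized.

Lemma finite_set_code (X Y : Type) (K : set X) (R : X -> Y -> Prop) :
  finite_set [set: Y] -> (forall x, K x -> exists y, R x y) ->
  (forall x x' y, K x -> K x' -> R x y -> R x' y -> x = x') -> finite_set K.
Proof.
move=> fY RK Rinj.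
have /choice[f fP] : forall x, exists oy, K x -> exists2 y, oy = Some y & R x y.
  move=> x; have [/RK[y Rxy]|] := pselect (K x); last by exists None.
  by exists (Some y) => _; exists y.
suff : (f @` K #= K)%card.
  move=> /eq_finite_set <-; apply: (@sub_finite_set _ _ [set Some y | y in [set: Y]]).
    by move=> _ [x /fP[y -> _] <-]; exists y.
  exact: finite_image.
apply: inj_card_eq => x x' /set_mem Kx /set_mem Kx' fxx'.
have [[y fy Rxy] [y' fy' Ry']] := (fP _ Kx, fP _ Kx').
by apply: Rinj Rxy _ => //; move: Ry'; rewrite fxx' fy' in fy; case: fy => ->.
Qed.

(** The tuple that determines limits enumerates the two models, a representative
    of e and one of d; all limits are taken with respect to this one tuple. *)
Lemma gal_limit (L : language) (M : structure L) (kappa : Type) (E D : td_equiv M)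
    (e : himag E) (d : himag D) (U : set_system nat) :
  small kappa [set: nat] -> saturated M kappa -> strongly_homogeneous M kappa ->
  small kappa [set: tidx E] -> small kappa [set: tidx D] ->
  G_compact kappa e -> UltraFilter U ->
  exists lim : (nat -> gal kappa e) -> gal kappa e,
    [/\ forall x y, lim (fun n => x n * y n) = lim x * lim y,
        forall x, lim (fun=> x) = x
      & forall x, U [set n | stab_class d (x n)] -> stab_class d (lim x)].
Proof.
move=> smN satM homM smE smD [N1 [N2 closed1]] UU.
have [a ea] : exists a, e = hcls E a.
  by have [a aE] := hclassP e; exists a; apply: himag_ext.
have [b db] : exists b, d = hcls D b.
  by have [b bE] := hclassP d; exists b; apply: himag_ext.
pose w := joint (joint (val : smodel N1 -> M) (val : smodel N2 -> M)) (joint a b).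
have smW : small kappa [set: ((smodel N1 + smodel N2) + (tidx E + tidx D))%type].
  by do !apply: small_sum => //; exact: small_smodel.
have wE : e = hcls E (w \o (inr \o inl)) by [].
exists (gal_lim smN satM homM UU smW wE); split.
- exact: (gal_limM smN satM homM UU closed1 smW (i1 := inl \o inl) (i2 := inl \o inr)).
- exact: (gal_lim_cst smN satM homM UU closed1 smW (i1 := inl \o inl) (i2 := inl \o inr)).
- rewrite db => x.
  exact: (gal_lim_stab smN satM homM UU closed1 smW (i1 := inl \o inl)
    (i2 := inl \o inr) erefl erefl wE (iD := inr \o inr)).
Qed.

Theorem corollary5p8 (L : language) (T : theory L) (kappa : Type)
    (M : structure L) (E F G : td_equiv M)
    (e : himag E) (b : himag F) (c : himag G) :
  complete_theory T -> monster M T kappa ->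
  small kappa [set: tidx E] -> small kappa [set: tidx F] ->
  small kappa [set: tidx G] ->
  acl_over c b e ->
  G_compact kappa e ->
  finite_set (ker_pi1 kappa e b c).
Proof.
move=> _ [_ smN _ _ [satM homM]] smE smF smG cacl Gc.
have [U [UU Uoo]] := free_ultrafilter.
have smFG : small kappa [set: tidx (td_pair F G)] by exact: small_sum.
have [lim [limM lim_cst limB]] := gal_limit (hpair b c) smN satM homM smE smFG Gc UU.
have [R Rfin RP] := stab_class_index kappa cacl.
have [s sP] := finitely_many_conjugates UU Uoo limM lim_cst
  (stab_class_subgroup kappa e (hpair b c)) limB (ex_intro2 _ _ R Rfin RP).
have [l lR] : exists l : seq {classic gal kappa e}, R = [set` l] by exact/finite_seqP.
pose proj := qproj (autf kappa e).
(* An element of the kernel is coded by the cosets to which its conjugates by the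
   finitely many entries of s belong. *)
pose code (x : gal1 kappa e (hpair b c)) (y : {ffun 'I_(size s) -> 'I_(size l)}) :=
  exists f : autE e, [/\ x = qproj (autf1 kappa e (hpair b c)) (restr (hpair b c) f),
    forall g, stab_class b (g^-1 * proj f * g)
  & forall i : 'I_(size s), let g := nth 1 s i in
    stab_class (hpair b c) ((nth 1 l (y i))^-1 * (g^-1 * proj f * g))].
apply: (@finite_set_code _ _ _ code); first exact: finite_finset.
  move=> x; have [f ->] := gal1_surj x.
  rewrite /ker_pi1 /= pi1E => /esym/qprojP; rewrite invg1 mul1g => /autf1_stab bf.
  have /choice[y yP] : forall i : 'I_(size s), exists y : 'I_(size l),
      let g := nth 1 s i in
      stab_class (hpair b c) ((nth 1 l y)^-1 * (g^-1 * proj f * g)).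
    move=> i; have [t] := RP _ (bf (nth 1 s i)).
    rewrite lR => tl; have kl : (index (t : {classic gal kappa e}) l < size l)%N.
      by rewrite index_mem.
    by exists (Ordinal kl); rewrite /= (@nth_index {classic gal kappa e}).
  by exists (finfun y), f; split=> // i; rewrite ffunE; exact: yP.
move=> x x' y _ _ [f [-> bf fy]] [f' [-> bf' fy']]; apply/qprojP.
rewrite -gmulfV -gmulfM; apply/autf1_stab.
have conjE g : g^-1 * qproj (autf kappa e) (f^-1 * f') * g =
    (g^-1 * proj f * g)^-1 * (g^-1 * proj f' * g).
  by rewrite qprojM qprojV !invgM invgK !mulgA !(mulgK, mulgVK).
have [_ bM bV] := stab_class_subgroup kappa e b.
have [_ bcM bcV] := stab_class_subgroup kappa e (hpair b c).
apply: sP => g; first by rewrite conjE; apply: bM => //; exact: bV.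
move=> /(nthP 1)[i is_ <-]; rewrite conjE.
have := bcM _ _ (bcV _ (fy (Ordinal is_))) (fy' (Ordinal is_)).
by rewrite /= invgM invgK -mulgA mulVKg.
Qed.
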